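(* Let the limiting network be the directed marked kernel branching process $(\mathsf T_\kappa,o,\mathcal M(\mathsf T_\kappa))$ defined in the context, with $\|\kappa\|_\infty\le\bar\kappa<\infty$. If $f_v=f_{\tau_v}\in\mathsf F_{\mathrm{ne}}$ for all vertices $v$ and $B(t)=\mathfrak b(f_t)$ belongs to $L^1(\mathcal T,\mu)$, then root coalescence holds, i.e. $x_o^{+,k}-x_o^{-,k}\to0$ almost surely as $k\to\infty$.
   Context: $\mathcal T$ is a Polish space of types, $\mu$ a Borel probability measure on $\mathcal T$, and $\kappa:\mathcal T\times\mathcal T\to[0,\infty)$ a bounded continuous kernel. $\mathsf F_{\mathrm{ne}}$ is the set of bounded, nonnegative, nondecreasing, $1$-Lipschitz functions $f:\mathbb R\to\mathbb R$ (with the uniform metric), and $\mathfrak b(f):=\sup_zf(z)$. $(f_s)_{s\in\mathcal T}$ is a measurable family in $\mathsf F_{\mathrm{ne}}$; $\zeta_s$ is the shock law at type $s$ (a probability kernel from $\mathcal T$ to $\mathbb R$) and $\mathsf K_s^V(de,df)=\zeta_s(de)\delta_{f_s}(df)$; $\mathsf K^E_{s,t}$ is a probability kernel from $\mathcal T\times\mathcal T$ to $(0,\infty)$ (law of the exposure on an edge from type $s$ to type $t$). **Directed marked kernel branching process.** Set $\Lambda_s(dt)=\kappa(s,t)\mu(dt)$. The random rooted tree $\mathsf T_\kappa$ has root type $\tau_o\sim\mu$ and edges directed from parents to children. For every $r\ge0$, conditional on the typed tree through generation $r$, the offspring-type point measures $\Pi_v=\sum_{u:(v,u)\in E}\delta_{\tau_u}$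 of its generation-$r$ vertices $v$ are independent, $\Pi_v$ being a Poisson random measure with intensity $\Lambda_{\tau_v}$ (atoms counted with multiplicity and corresponding to distinct children). Conditional on the entire typed tree, vertex marks $(\epsilon_v,f_v)$ and edge marks $C_{vu}$ are mutually independent with laws $\mathsf K^V_{\tau_v}$ and $\mathsf K^E_{\tau_v,\tau_u}$ respectively. Weights: $W_{vu}=C_{vu}/\sum_{w:(v,w)\in E}C_{vw}$ for an edge $(v,u)$; vertices without children have zero network input. Extremal iterates: $x_v^{-,0}=0$, $x_v^{+,0}=\mathfrak b(f_v)$, and $x_v^{\pm,k+1}=f_v\bigl(\sum_{u:(v,u)\in E}W_{vu}x_u^{\pm,k}+\epsilon_v\bigr)$ for all vertices $v$ and $k\ge0$. *)

(* Defs.v *)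
From HB Require Import structures.
From mathcomp Require Import all_boot all_order all_algebra.
From mathcomp Require Import all_classical all_reals all_analysis.

Set Implicit Arguments.
Unset Strict Implicit.
Unset Printing Implicit Defensive.

Import Order.TTheory GRing.Theory Num.Theory.
Import numFieldNormedType.Exports.

Local Open Scope classical_set_scope.
Local Open Scope ring_scope.

#[short(type="completeMetricType")]
HB.structure Definition CompleteMetric (R : numDomainType) :=
  {T of CompletePseudoMetric R T & PseudoMetric_isMetric R T}.

Definition separable (T : topologicalType) : Prop :=
  exists2 D : set T, countable D & dense D.

(* A Polish space is a separable [completeMetricType]; [borel T] is the same
   space equipped with its Borel sigma-algebra. *)
Notation borel T := (g_sigma_algebraType (@open T)).

Section response_functions.
Context {R : realType}.

Definition Fne : set (R -> R) :=
  [set f : R -> R | [/\ bounded_fun (f : R -> R^o), forall z, 0 <= f z,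
               {homo f : x y / x <= y} & 1.-lipschitz (f : R^o -> R^o)]].

Definition bsup (f : R -> R) : R := sup (range f).

End response_functions.

(* Functions R -> R with the Borel sigma-algebra of uniform convergence.  On the
   subset [Fne] its trace is the Borel sigma-algebra of the uniform metric, so a
   family with values in [Fne] is measurable into [Fne] iff it is into
   [response R]. *)
Definition uniform_open (R : realType) : set (set (R -> R)) :=
  @open {uniform R -> R}.

Notation response R := (g_sigma_algebraType (@uniform_open R)).

(* Random marked rooted trees, with Ulam-Harris labels: the root is [::] and the
   children of v are [rcons v i] for i < [offspring v].  The fields are defined on
   all labels, but only their values on the vertices of the tree ([intree]) are
   meaningful.  [exposure v i] is the mark C of the edge (v, rcons v i). *)
Record marked_tree (R : realType) (T : pointedType) (Omega : Type) := MarkedTree {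
  offspring : seq nat -> Omega -> nat ;
  vtype : seq nat -> Omega -> T ;
  shock : seq nat -> Omega -> R ;
  resp : seq nat -> Omega -> (R -> R) ;
  exposure : seq nat -> nat -> Omega -> R }.

Section marked_tree.
Context {R : realType} {T : pointedType} {Omega : Type}.
Variable X : marked_tree R T Omega.

Definition intree (v : seq nat) (w : Omega) : bool :=
  all (fun j => nth 0%N v j < offspring X (take j v) w)%N (iota 0 (size v)).

Definition weight (v : seq nat) (i : nat) (w : Omega) : R :=
  exposure X v i w / \sum_(j < offspring X v w) exposure X v j w.

Fixpoint iterate (x0 : seq nat -> Omega -> R) (k : nat) (v : seq nat)
    (w : Omega) : R :=
  if k is k'.+1 then
    resp X v w (\sum_(i < offspring X v w)
                  weight v i w * iterate x0 k' (rcons v i) w + shock X v w)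
  else x0 v w.

Definition xminus : nat -> seq nat -> Omega -> R := iterate (fun _ _ => 0).

Definition xplus : nat -> seq nat -> Omega -> R :=
  iterate (fun v w => bsup (resp X v w)).

End marked_tree.

Section kernel_branching.
Context {R : realType} {T : completeMetricType R}.

Definition offspring_intensity (mu : {measure set (borel T) -> \bar R})
    (kappa : T -> T -> R) (s : T) (A : set (borel T)) : \bar R :=
  (\int[mu]_(t in A) (kappa s t)%:E)%E.

Definition vertex_mark_law (zeta : R.-pker (borel T) ~> (measurableTypeR R))
    (f : T -> R -> R) (s : T) : set (measurableTypeR R * response R) -> \bar R :=
  (zeta s \x dirac (f s : response R))%E.

Context {d : measure_display} {Omega : measurableType d}.

(* Pi_v, the offspring-type point measure of v. *)
Definition offspring_pm (X : marked_tree R T Omega) (v : seq nat) (w : Omega)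
    (A : set (borel T)) : \bar R :=
  (\sum_(i < offspring X v w) \d_(vtype X (rcons v i) w : borel T) A)%E.

(* Generators of the sigma-algebra of the typed tree through generation r. *)
Definition typed_tree_events (X : marked_tree R T Omega) (r : nat) :
    set (set Omega) :=
  [set E | exists v (A : set (borel T)), [/\ (size v <= r)%N, measurable A &
     E = [set w | intree X v w /\ A (vtype X v w)]]].

(* Conditional laws given a sigma-algebra are stated by integrating over its
   elements G, on the event that all the labels involved are vertices.
   In [kbp_poisson] a point measure is a Poisson random measure when its values
   on disjoint measurable sets are independent Poisson variables; we use
   [poisson_prob] (whose nat argument is unused) and not [poisson_pmf] because the
   latter is not a probability mass function at rate 0. *)
Record kernel_branching_process (P : probability Omega R)
    (mu : probability (borel T) R) (kappa : T -> T -> R)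
    (zeta : R.-pker (borel T) ~> (measurableTypeR R)) (f : T -> R -> R)
    (KE : R.-pker (borel T * borel T) ~> (measurableTypeR R))
    (X : marked_tree R T Omega) : Prop := KernelBranchingProcess {
  kbp_offspring_meas : forall v, measurable_fun setT (offspring X v) ;
  kbp_vtype_meas : forall v,
    measurable_fun setT (vtype X v : Omega -> borel T) ;
  kbp_shock_meas : forall v,
    measurable_fun setT (shock X v : Omega -> measurableTypeR R) ;
  kbp_resp_meas : forall v,
    measurable_fun setT (resp X v : Omega -> response R) ;
  kbp_exposure_meas : forall v i,
    measurable_fun setT (exposure X v i : Omega -> measurableTypeR R) ;
  kbp_root : forall A : set (borel T), measurable A ->
    P [set w | A (vtype X [::] w)] = mu A ;
  kbp_poisson : forall (r m : nat) (vs : seq (seq nat))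
      (A : seq nat -> nat -> set (borel T)) (n : seq nat -> nat -> nat)
      (G : set Omega),
    uniq vs -> (forall v, v \in vs -> size v = r) ->
    (forall v j, measurable (A v j)) -> (forall v, trivIset setT (A v)) ->
    <<s typed_tree_events X r >> G ->
    let H := G `&` [set w | forall v, v \in vs -> intree X v w] in
    P (H `&` [set w | forall v j, v \in vs -> (j < m)%N ->
                        offspring_pm X v w (A v j) = (n v j)%:R%:E]) =
    (\int[P]_(w in H) \prod_(v <- vs) \prod_(j < m)
       poisson_prob (fine (offspring_intensity mu kappa (vtype X v w) (A v j)))
                    0%N [set n v j])%E ;
  kbp_marks : forall (vs : seq (seq nat)) (es : seq (seq nat * nat))
      (A : seq nat -> set (measurableTypeR R * response R))
      (B : seq nat * nat -> set (measurableTypeR R)) (G : set Omega),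
    uniq vs -> uniq es ->
    (forall v, measurable (A v)) -> (forall e, measurable (B e)) ->
    <<s \bigcup_r typed_tree_events X r >> G ->
    let H := G `&` [set w | forall v, v \in vs -> intree X v w]
               `&` [set w | forall e, e \in es -> intree X (rcons e.1 e.2) w] in
    P (H `&` [set w | forall v, v \in vs -> A v (shock X v w, resp X v w)]
         `&` [set w | forall e, e \in es -> B e (exposure X e.1 e.2 w)]) =
    (\int[P]_(w in H)
       ((\prod_(v <- vs) vertex_mark_law zeta f (vtype X v w) (A v)) *
        (\prod_(e <- es)
           KE (vtype X e.1 w, vtype X (rcons e.1 e.2) w) (B e))))%E }.

End kernel_branching.

(* Main.v *)
Require Import Defs.
From HB Require Import structures.
From mathcomp Require Import all_boot all_order all_algebra.
From mathcomp Require Import all_classical all_reals all_analysis.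
From mathcomp Require Import measurable_realfun ring lra.

(** Why the root coalesces.

Let [D_k(v)] be the gap between the two extremal iterates at the vertex [v].
Since the response at [v] is 1-Lipschitz, [D_(k+1)(v)] is at most the
[W]-weighted average of the gaps [D_k(u)] of the children [u] of [v]
([deviation_contract]), and [D_0(v)] is the supremum [B(tau_v)] of the
response. Unrolling down to generation [k] bounds [D_k] at the root by

     U_k  =  sum over the vertices v of generation k of  path(v) B(tau_v),

where [path(v)] is the product of the edge weights from the root to [v]
([deviation_le_weighted_mass]). Almost sure convergence follows from [sum_k
E(U_k) < oo].

The mean of [U_k] decays geometrically because a vertex without children has
no input. The weights out of a vertex add up to 1 if it has children and to 0
otherwise, and given the past it is childless with probability [exp(-
Lambda(T))], which is at least [exp(- kbar)]; hence [E (sum_(|v| = k) path(v))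
<= (1 - exp(- kbar)) ^ k] ([surviving_mass]). As [B] is only integrable, the
last generation is treated differently: its weights are bounded by 1, and the
Poisson points of a vertex carry a mean [B]-mass of at most [kbar * int B dmu]
([path_weight_children]). Together, [E(U_(k+1)) <= kbar * int B dmu * (1 -
exp(- kbar)) ^ k].

The probabilistic content is one identity: the offspring of a vertex [v] of
generation [r] is still Poisson given the typed tree through generation [r]
and all the exposures of the edges inside it, which together determine
[path(v)] ([count_given_revealed]). It is first obtained on a pi-system, by
combining the conditional Poisson law given the typed tree with the
conditional law of the exposures given the whole typed tree, and then extended
by Dynkin's theorem. The passage from events to the nonnegative factor
[path(v)] is [le_integral_comp_mul]. *)

Set Implicit Arguments.
Unset Strict Implicit.
Unset Printing Implicit Defensive.

Import Order.TTheory GRing.Theory Num.Theory.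
Import numFieldNormedType.Exports.

Local Open Scope classical_set_scope.
Local Open Scope ring_scope.

(** * Comparing integrals through a sub-sigma-algebra *)

Section density.
Local Open Scope ereal_scope.
Context d (X : measurableType d) (R : realType).
Variable mu : {measure set X -> \bar R}.

(** The proofs of measurability and nonnegativity are arguments so that the
measure structure below can be inferred. *)
Definition density (g : X -> \bar R)
    of measurable_fun [set: X] g & (forall x, 0 <= g x) :=
  fun A : set X => \int[mu]_(x in A) g x.

Variables (g : X -> \bar R) (mg : measurable_fun [set: X] g).
Hypothesis g0 : forall x, 0 <= g x.

Let density_set0 : density mg g0 set0 = 0.
Proof. by rewrite /density integral_set0. Qed.

Let density_ge0 A : 0 <= density mg g0 A.
Proof. by apply: integral_ge0 => x _. Qed.

Let density_sigma_additive : semi_sigma_additive (density mg g0).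
Proof.
move=> F mF tF mUF; rewrite /density ge0_integral_bigcup//; last first.
  exact: measurable_funTS.
by apply: is_cvg_nneseries => n _ _; exact: integral_ge0.
Qed.

HB.instance Definition _ := isMeasure.Build _ _ _ (density mg g0)
  density_set0 density_ge0 density_sigma_additive.

Import HBNNSimple.

Lemma ge0_integral_density (f : X -> \bar R) :
  measurable_fun [set: X] f -> (forall x, 0 <= f x) ->
  \int[density mg g0]_x f x = \int[mu]_x (f x * g x).
Proof.
move=> mf f0; pose f_ := nnsfun_approx measurableT mf.
have nd_f x : nondecreasing_seq (fun n => (f_ n x)%:E).
  by move=> m n mn; rewrite lee_fin; exact/lefP/nd_nnsfun_approx.
have cvg_f x : (f_ n x)%:E @[n --> \oo] --> f x.
  by apply: (cvg_nnsfun_approx measurableT mf (fun x _ => f0 x)).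
have cvg_fg x : (f_ n x)%:E * g x @[n --> \oo] --> f x * g x.
  have [gfin|goo] := boolP (g x \is a fin_num); first exact: cvgeZr.
  have [fx0|fx0] := eqVneq (f x) 0; last first.
    by apply: cvgeM => //; [exact: mule_def_neq0_infty|exact: cvg_cst].
  suff -> : (fun n => (f_ n x)%:E * g x) = cst 0.
    by rewrite fx0 mul0e; exact: cvg_cst.
  apply/funext => n; have : (f_ n x)%:E <= f x.
    have /cvg_lim <- := cvg_f x => //.
    have /cvg_lim -> := ereal_nondecreasing_cvgn (nd_f x) => //.
    by apply: ereal_sup_ubound; exists n.
  by rewrite fx0 lee_fin => fn0; have -> : f_ n x = 0%R;
    [apply/eqP; rewrite eq_le fn0/=|rewrite mul0e].
transitivity (limn (fun n => \int[density mg g0]_x (f_ n x)%:E)).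
  rewrite -monotone_convergence//.
  - by apply: eq_integral => x _; apply/esym/cvg_lim.
  - by move=> n; exact/measurable_EFinP.
  - by move=> n x _; rewrite lee_fin.
transitivity (limn (fun n => \int[mu]_x ((f_ n x)%:E * g x))); last first.
  rewrite -monotone_convergence//.
  - by apply: eq_integral => x _; apply/cvg_lim.
  - by move=> n; apply: emeasurable_funM => //; exact/measurable_EFinP.
  - by move=> n x _; rewrite mule_ge0// lee_fin.
  - by move=> x _ m n mn; rewrite lee_wpmul2r//; exact: nd_f.
congr (limn _); apply/funext => n.
under [LHS]eq_integral do rewrite fimfunE -fsumEFin//.
rewrite ge0_integral_fsum//; last 2 first.
  - by move=> y; exact/measurable_EFinP/measurable_funM.
  - by move=> y x _; rewrite nnfun_muleindic_ge0.
transitivity (\int[mu]_x \sum_(y \in range (f_ n))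
   (y * \1_(f_ n @^-1` [set y]) x)%:E * g x); last first.
  apply: eq_integral => x _; rewrite fimfunE -fsumEFin//.
  rewrite !fsbig_finite//= ge0_sume_distrl// => y _.
  by rewrite nnfun_muleindic_ge0.
rewrite ge0_integral_fsum//; last 2 first.
  - move=> y; apply: emeasurable_funM => //.
    exact/measurable_EFinP/measurable_funM.
  - by move=> y x _; rewrite mule_ge0// nnfun_muleindic_ge0.
apply: eq_fsbigr => r; rewrite inE => -[t _ rt].
have r0 : (0 <= r)%R by rewrite -rt.
under eq_integral do rewrite EFinM.
under [RHS]eq_integral do rewrite EFinM -muleA.
rewrite !ge0_integralZl_EFin//.
- rewrite integral_indic// setIT; congr (_ * _).
  rewrite /= /density integral_mkcond; apply: eq_integral => x _.
  by rewrite patchE indicE; case: ifP; rewrite ?mul1e ?mul0e.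
- by move=> x _; rewrite mule_ge0// lee_fin.
- by apply: emeasurable_funM => //; exact/measurable_EFinP.
- exact/measurable_EFinP.
Qed.

End density.

Section comparison.
Local Open Scope ereal_scope.
Context d d' (X : measurableType d) (Y : measurableType d') (R : realType).
Variables (mu : {measure set X -> \bar R}) (phi : X -> Y).
Hypothesis mphi : measurable_fun [set: X] phi.

(** The use below is with [Y] the set [X] under a smaller sigma-algebra and
[phi] the identity: if [g] has a smaller conditional expectation than [h], it
suffices to see this on events for the inequality to survive multiplication by
a nonnegative [f] known to the smaller sigma-algebra. *)
Lemma le_integral_comp_mul (g h : X -> \bar R) (f : Y -> \bar R) :
  measurable_fun [set: X] g -> (forall x, 0 <= g x) ->
  measurable_fun [set: X] h -> (forall x, 0 <= h x) ->
  measurable_fun [set: Y] f -> (forall y, 0 <= f y) ->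
  (forall E, measurable E -> \int[mu]_(x in phi @^-1` E) g x <=
                             \int[mu]_(x in phi @^-1` E) h x) ->
  \int[mu]_x (f (phi x) * g x) <= \int[mu]_x (f (phi x) * h x).
Proof.
move=> mg g0 mh h0 mf f0 gh.
have mfphi : measurable_fun [set: X] (f \o phi) by exact: measurableT_comp.
have f0phi x : 0 <= (f \o phi) x by exact: f0.
rewrite -(ge0_integral_density mu mg g0 mfphi f0phi).
rewrite -(ge0_integral_density mu mh h0 mfphi f0phi).
rewrite -[setT](preimage_setT phi) -!(ge0_integral_pushforward mphi)//.
by apply: ge0_le_measure_integral => // E mE; exact: gh.
Qed.

Lemma eq_integral_comp_mul (g h : X -> \bar R) (f : Y -> \bar R) :
  measurable_fun [set: X] g -> (forall x, 0 <= g x) ->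
  measurable_fun [set: X] h -> (forall x, 0 <= h x) ->
  measurable_fun [set: Y] f -> (forall y, 0 <= f y) ->
  (forall E, measurable E -> \int[mu]_(x in phi @^-1` E) g x =
                             \int[mu]_(x in phi @^-1` E) h x) ->
  \int[mu]_x (f (phi x) * g x) = \int[mu]_x (f (phi x) * h x).
Proof.
move=> mg g0 mh h0 mf f0 gh; apply/eqP; rewrite eq_le.
by apply/andP; split; apply: le_integral_comp_mul => // E mE; rewrite gh.
Qed.

End comparison.

(** The form taken by every datum of the tree: a field such as [vtype X v] is
informative only on the event that [v] is a vertex, so the sigma-algebras of the
tree make it measurable only after it is given a default value elsewhere. *)
Lemma measurable_fun_default d d' (X : measurableType d) (Y : measurableType d')
    (b : X -> bool) (g : X -> Y) (c : Y) :
  measurable [set x | b x] ->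
  (forall A, measurable A -> measurable [set x | b x /\ A (g x)]) ->
  measurable_fun [set: X] (fun x => if b x then g x else c).
Proof.
move=> mb mbg _ A mA; rewrite setTI.
have -> : (fun x => if b x then g x else c) @^-1` A =
    [set x | b x /\ A (g x)] `|` ([set x | A c] `&` ~` [set x | b x]).
  by apply/seteqP; split => x /=; case: ifPn => bx;
    [left|right|move=> [[]|[]]|move=> [[]|[]]].
apply: measurableU; first exact: mbg.
apply: measurableI; last exact: measurableC.
have [Ac|nAc] := pselect (A c).
  by rewrite (_ : [set _ | _] = setT)//; apply/seteqP; split.
by rewrite (_ : [set _ | _] = set0)//; apply/seteqP; split.
Qed.

Lemma measurable_EFin_indic d (X : measurableType d) (R : realType)
    (D A : set X) : measurable A ->
  measurable_fun D (fun x => (\1_A x)%:E : \bar R).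
Proof. by move=> mA; exact/measurable_EFinP/measurable_indic. Qed.

Lemma nneseries_finite_support (R : realType) (u : nat -> \bar R) n :
  (forall i, 0 <= u i)%E -> (forall i, (n <= i)%N -> u i = 0)%E ->
  (\sum_(i <oo) u i = \sum_(i < n) u i)%E.
Proof.
move=> u0 un; rewrite (nneseries_split 0 n)// add0n big_mkord.
by rewrite eseries0 ?adde0// => i ni _; exact: un.
Qed.

(** * The Poisson law *)

Section poisson.
Context (R : realType).

Lemma poisson_prob1E (r : R) n : poisson_prob r 0 [set n] =
  (if 0 < r then poisson_pmf r n else (n == 0%N)%:R)%:E.
Proof.
rewrite /poisson_prob; case: ifPn => r0.
  by rewrite esum_set1// lee_fin poisson_pmf_ge0.
rewrite diracE; congr (_%:E); have [->|n0] := eqVneq n 0%N.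
  by rewrite mem_set.
by rewrite memNset//= => n0'; rewrite -n0' eqxx in n0.
Qed.

Lemma poisson_prob_eq0 (r : R) : 0 <= r ->
  poisson_prob r 0 [set 0%N] = (expR (- r))%:E.
Proof.
move=> r0; rewrite poisson_prob1E /poisson_pmf; case: ltP => [_|r0'].
  by rewrite expr0 fact0 mul1r invr1 mul1r.
have -> : r = 0 by apply/eqP; rewrite eq_le r0 r0'.
by rewrite oppr0 expR0.
Qed.

(** The [n]-th term is [r] times the probability of [n - 1], and the
probabilities add up to 1. *)
Lemma poisson_mean_le (r : R) : 0 <= r ->
  (\sum_(n <oo) n%:R%:E * poisson_prob r 0 [set n] <= r%:E)%E.
Proof.
rewrite le_eqVlt => /predU1P[<-|r0].
  rewrite eseries0// => n _ _; rewrite poisson_prob1E ltxx.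
  by case: n => [|n]; rewrite ?mul0e ?mule0.
have p0 n : (0 <= n%:R%:E * poisson_prob r 0 [set n])%E.
  by rewrite mule_ge0// lee_fin.
rewrite nneseries_recl// mul0e add0e.
rewrite -(@nneseries_addn _ _ 1)//.
under eq_eseriesr => n _.
  rewrite addn1 (_ : _ * _ = r%:E * poisson_prob r 0 [set n])%E; last first.
    rewrite !poisson_prob1E r0 -!EFinM /poisson_pmf r0; congr (_%:E).
    rewrite factS natrM exprS invfM.
    have n1 : n.+1%:R != 0 :> R by rewrite pnatr_eq0.
    have f1 : n`!%:R != 0 :> R by rewrite pnatr_eq0 -lt0n fact_gt0.
    move: (n.+1%:R) (n`!%:R) n1 f1 => a b a0 b0.
    by field; rewrite a0 b0.
  over.
rewrite nneseriesZl//.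
have -> : (\sum_(i <oo) poisson_prob r 0 [set i] = 1)%E.
  have <- : (if (0 < r)%R then \esum_(k in [set: nat]) (poisson_pmf r k)%:E
             else \d_0%N [set: nat])%E = 1%E.
    exact: probability_setT (poisson_prob r 0%N).
  rewrite r0 nneseries_esumT//.
  by apply: eq_esum => n _; rewrite poisson_prob1E r0.
by rewrite mule1.
Qed.

End poisson.

Arguments le_integral_comp_mul {d d' X Y R mu phi} mphi g h f.
Arguments eq_integral_comp_mul {d d' X Y R mu phi} mphi g h f.

(** * The offspring intensity as a function of the type *)

Section intensity.
Context (R : realType) (T : completeMetricType R).

Lemma continuous_borel_measurable (g : T -> R) :
  continuous g ->
  measurable_fun [set: borel T] (g : borel T -> measurableTypeR R).
Proof.
move=> cg; apply: (measurability _ (RGenOpens.measurableE R)).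
move=> _ [_ [a [b ->] <-]].
rewrite setTI; apply: sub_sigma_algebra.
by apply: open_comp; [move=> x _; exact: cg|exact: interval_open].
Qed.

Lemma sequentially_continuous_continuous (g : T -> R) :
  (forall (s_ : nat -> T) (s : T), s_ n @[n --> \oo] --> s ->
     g (s_ n) @[n --> \oo] --> g s) -> continuous g.
Proof.
move=> gseq s; apply/cvgrPdist_lt => e e0; apply: contrapT => ngs.
have /choice[s_ s_P] : forall n, exists t : T,
    ball s n.+1%:R^-1 t /\ e <= `|g s - g t|.
  move=> n; apply: contrapT => nt; apply: ngs.
  near=> t; rewrite ltNge; apply/negP => gt; apply: nt; exists t; split => //.
  by near: t; apply: nbhsx_ballx; rewrite invr_gt0.
have s_s : s_ n @[n --> \oo] --> s.
  apply/cvg_ballP => r r0; near=> n.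
  apply: (@le_ball _ _ _ n.+1%:R^-1); last exact: (s_P n).1.
  by apply: ltW; near: n; exact: near_infty_natSinv_lt (PosNum r0).
have /cvgrPdist_lt/(_ e e0) [N _ gN] := gseq _ _ s_s.
by have := gN N (leqnn _); rewrite ltNge (s_P N).2.
Unshelve. all: by end_near. Qed.

Variables (mu : probability (borel T) R) (kappa : T -> T -> R).
Hypothesis kappa_ge0 : forall s t, 0 <= kappa s t.
Hypothesis kappa_continuous : continuous (fun p : T * T => kappa p.1 p.2).
Variables (kbar : R) (kappa_bounded : forall s t, `|kappa s t| <= kbar).

Lemma kappa_continuous_l t : continuous (kappa^~ t).
Proof.
move=> s; apply: (@continuous_comp T (T * T)%type R (pair^~ t)
  (fun p => kappa p.1 p.2)); last exact: kappa_continuous.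
by apply: cvg_pair; [exact: cvg_id|exact: cvg_cst].
Qed.

Lemma kappa_continuous_r s : continuous (kappa s).
Proof.
move=> t; apply: (@continuous_comp T (T * T)%type R (pair s)
  (fun p => kappa p.1 p.2)); last exact: kappa_continuous.
by apply: cvg_pair; [exact: cvg_cst|exact: cvg_id].
Qed.

Lemma measurable_kappa s :
  measurable_fun [set: borel T] (fun t : borel T => (kappa s t)%:E).
Proof.
apply/measurable_EFinP.
exact: continuous_borel_measurable (@kappa_continuous_r s).
Qed.

Local Notation intensity := (offspring_intensity mu kappa).

Lemma intensity_ge0 s A : (0 <= intensity s A)%E.
Proof. by apply: integral_ge0 => t _; rewrite lee_fin. Qed.

Lemma kbar_ge0 : 0 <= kbar.
Proof. exact: le_trans (kappa_bounded point point). Qed.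

Lemma intensity_le s A : measurable A -> (intensity s A <= kbar%:E * mu A)%E.
Proof.
move=> mA; rewrite -integral_cst//; apply: ge0_le_integral => //.
- by move=> t _; rewrite lee_fin.
- exact: measurable_funTS (measurable_kappa _).
- by move=> t _; rewrite lee_fin (le_trans (ler_norm _)).
Qed.

Lemma intensity_fin_num s A : measurable A -> intensity s A \is a fin_num.
Proof.
move=> mA; rewrite ge0_fin_numE ?intensity_ge0//.
apply: le_lt_trans (intensity_le s mA) _.
rewrite lte_mul_pinfty ?lee_fin ?kbar_ge0//.
by rewrite (le_lt_trans (probability_le1 _ mA)) ?ltry.
Qed.

(** Regularity in the type makes the conditional offspring law, a function of
the random type of the parent, measurable. Dominated convergence is available
along sequences only, which is enough on a metric space. *)
Lemma continuous_intensity A : measurable A ->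
  continuous (fun s : T => fine (intensity s A)).
Proof.
move=> mA; apply: sequentially_continuous_continuous => s_ s s_s.
have [] := @dominated_convergence _ _ _ mu A mA
  (fun n t => (kappa (s_ n) t)%:E) (fun t => (kappa s t)%:E) (cst kbar%:E).
- by move=> n; exact: measurable_funTS (measurable_kappa _).
- exact: measurable_funTS (measurable_kappa _).
- apply: aeW => t _; apply: cvg_EFin; first exact: nearW.
  apply: (@cvg_comp _ _ _ s_ (kappa^~ t) \oo (nbhs s)) => //.
  exact: kappa_continuous_l.
- apply/integrableP; split; first exact: measurable_cst.
  under eq_integral do rewrite /= ger0_norm ?kbar_ge0//.
  rewrite integral_cst// lte_mul_pinfty ?lee_fin ?kbar_ge0//.
  by rewrite (le_lt_trans (probability_le1 _ mA)) ?ltry.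
- by apply: aeW => t n _; rewrite lee_fin.
move=> _ _ cvg_int; suff /fine_cvgP[_] :
  intensity (s_ n) A @[n --> \oo] --> (fine (intensity s A))%:E by [].
by rewrite fineK// intensity_fin_num.
Qed.

Lemma measurable_intensity A : measurable A ->
  measurable_fun [set: borel T]
    (fun s : borel T => fine (intensity s A) : measurableTypeR R).
Proof.
by move=> mA; apply: continuous_borel_measurable; exact: continuous_intensity.
Qed.

End intensity.

(** * Labels and generations *)

Section tree.
Context (R : realType) (T : pointedType) (Omega : Type).
Variable X : marked_tree R T Omega.

Lemma intree_rcons v i w :
  intree X (rcons v i) w = intree X v w && (i < offspring X v w)%N.
Proof.
rewrite /intree size_rcons -addn1 iotaD all_cat /= andbT add0n.
have -> : take (size v) (rcons v i) = v by rewrite -cats1 take_size_cat.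
rewrite nth_rcons ltnn eqxx; congr andb.
apply: eq_in_all => j; rewrite mem_iota add0n => /andP[_ jv].
by rewrite nth_rcons jv -cats1 takel_cat// ltnW.
Qed.

End tree.

Section generation_sum.
Local Open Scope ereal_scope.
Context (R : realType).
Implicit Types g h : seq nat -> \bar R.

(** The sum of [g] over the labels of length [k], written as [k] nested series
so that an estimate for the children of one vertex can be applied inside it.
*)
Fixpoint generation_sum k g : \bar R :=
  if k is k'.+1 then generation_sum k' (fun v => \sum_(i <oo) g (rcons v i))
  else g [::].

Lemma generation_sum_ge0 k g : (forall v, 0 <= g v) -> 0 <= generation_sum k g.
Proof.
elim: k g => [|k ih] g g0; first exact: g0.
by apply: ih => v; apply: nneseries_ge0.
Qed.

Lemma le_generation_sum k g h : (forall v, 0 <= g v) ->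
  (forall v, g v <= h v) -> generation_sum k g <= generation_sum k h.
Proof.
elim: k g h => [|k ih] g h g0 gh; first exact: gh.
by apply: ih => v; [exact: nneseries_ge0|exact: lee_nneseries].
Qed.

Lemma generation_sumZl k (c : R) g : (forall v, 0 <= g v) ->
  generation_sum k (fun v => c%:E * g v) = c%:E * generation_sum k g.
Proof.
elim: k g => [//|k ih] g g0 /=; rewrite -ih; last first.
  by move=> v; exact: nneseries_ge0.
by congr generation_sum; apply/funext => v; rewrite nneseriesZl.
Qed.

Context d (Omega : measurableType d) (P : {measure set Omega -> \bar R}).

Lemma measurable_generation_sum k (g : seq nat -> Omega -> \bar R) :
  (forall v, measurable_fun [set: Omega] (g v)) -> (forall v w, 0 <= g v w) ->
  measurable_fun [set: Omega] (fun w => generation_sum k (g^~ w)).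
Proof.
elim: k g => [|k ih] g mg g0; first exact: mg.
apply: (ih (fun v w => \sum_(i <oo) g (rcons v i) w)).
  by move=> v; exact: ge0_emeasurable_sum.
by move=> v w; exact: nneseries_ge0.
Qed.

Lemma integral_generation_sum k (g : seq nat -> Omega -> \bar R) :
  (forall v, measurable_fun [set: Omega] (g v)) -> (forall v w, 0 <= g v w) ->
  \int[P]_w generation_sum k (g^~ w) =
    generation_sum k (fun v => \int[P]_w g v w).
Proof.
elim: k g => [//|k ih] g mg g0 /=.
rewrite (ih (fun v w => \sum_(i <oo) g (rcons v i) w)).
- by congr generation_sum; apply/funext => v; rewrite integral_nneseries.
- by move=> v; exact: ge0_emeasurable_sum.
- by move=> v w; exact: nneseries_ge0.
Qed.

End generation_sum.

(** * Conditional laws of the branching process *)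

Section process.
Context (R : realType) (T : completeMetricType R).
Variables (mu : probability (borel T) R) (kappa : T -> T -> R).
Hypothesis kappa_ge0 : forall s t, 0 <= kappa s t.
Hypothesis kappa_continuous : continuous (fun p : T * T => kappa p.1 p.2).
Variables (kbar : R) (kappa_bounded : forall s t, `|kappa s t| <= kbar).
Variables (f : T -> R -> R) (zeta : R.-pker (borel T) ~> (measurableTypeR R)).
Variable KE : R.-pker (borel T * borel T) ~> (measurableTypeR R).
Context (d : measure_display) (Omega : measurableType d).
Variables (P : probability Omega R) (X : marked_tree R T Omega).
Hypothesis X_kbp : kernel_branching_process P mu kappa zeta f KE X.

Local Notation intensity := (offspring_intensity mu kappa).

Definition vertex_event v : set Omega := [set w | intree X v w].

Definition type_event v (A : set (borel T)) : set Omega :=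
  [set w | intree X v w /\ A (vtype X v w)].

Lemma measurable_vertex_event v : measurable (vertex_event v).
Proof.
rewrite /vertex_event /intree; elim: (iota _ _) => [|j s ih] /=.
  by rewrite (_ : [set _ | _] = setT)//; apply/seteqP; split.
rewrite (_ : [set _ | _] =
  (offspring X (take j v) @^-1` [set n | (nth 0%N v j < n)%N]) `&`
  [set w | all (fun j => nth 0%N v j < offspring X (take j v) w)%N s]).
  apply: measurableI => //; rewrite -[X in measurable X]setTI.
  exact: (kbp_offspring_meas X_kbp).
by apply/seteqP; split => w /=; [move/andP|move=> ?; apply/andP].
Qed.

Lemma measurable_type_event v A : measurable A -> measurable (type_event v A).
Proof.
move=> mA; apply: measurableI; first exact: measurable_vertex_event.
by rewrite -[X in measurable X]setTI; exact: (kbp_vtype_meas X_kbp).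
Qed.

Local Notation typed r := (<<s typed_tree_events X r >>).

Lemma typed_measurable r : typed r `<=` measurable.
Proof.
apply: smallest_sub; first exact: sigma_algebra_measurable.
move=> _ [v [A [_ mA ->]]]; exact: measurable_type_event.
Qed.

Lemma typed_bigcup r : typed r `<=` <<s \bigcup_r typed_tree_events X r >>.
Proof. by apply: sub_sigma_algebra2; exact: bigcup_sup. Qed.

Lemma typed_type_event r v A : (size v <= r)%N -> measurable A ->
  typed r (type_event v A).
Proof. by move=> vr mA; apply: sub_sigma_algebra; exists v, A. Qed.

Lemma typed_vertex_event r v : (size v <= r)%N -> typed r (vertex_event v).
Proof.
move=> vr; have -> : vertex_event v = type_event v setT.
  by apply/seteqP; split => w //= [].
exact: typed_type_event.
Qed.

Local Notation typedType r := (g_sigma_algebraType (typed_tree_events X r)).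

Lemma measurable_id_typed r :
  measurable_fun [set: Omega] (id : Omega -> typedType r).
Proof. by move=> _ A mA; rewrite setTI; exact: typed_measurable mA. Qed.

Lemma measurable_fun_type d' (Y : measurableType d') r v (g : borel T -> Y)
    (c : Y) : (size v <= r)%N -> measurable_fun [set: borel T] g ->
  measurable_fun [set: typedType r]
    (fun w => if intree X v w then g (vtype X v w) else c).
Proof.
move=> vr mg; apply: (@measurable_fun_default _ _ (typedType r)).
  exact: typed_vertex_event.
move=> A mA; apply: (typed_type_event (A := g @^-1` A)) => //.
by rewrite -[X in measurable X]setTI; exact: mg.
Qed.

Definition count_event v (A : set (borel T)) n : set Omega :=
  [set w | intree X v w /\ offspring_pm X v w A = n%:R%:E].

(** This is [offspring_pm X v w A] when [v] is a vertex, as a series of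
indicators of events of the typed tree. *)
Definition children_in v (A : set (borel T)) w : \bar R :=
  (\sum_(i <oo) (\1_(type_event (rcons v i) A) w)%:E)%E.

Lemma offspring_pmE v A w : intree X v w ->
  offspring_pm X v w A = children_in v A w.
Proof.
move=> vw; rewrite /children_in.
rewrite (@nneseries_finite_support _ _ (offspring X v w)).
- rewrite /offspring_pm; apply: eq_bigr => i _; rewrite diracE indicE.
  congr (_%:R%:E); congr nat_of_bool; apply/idP/idP; rewrite !inE /type_event/=.
    by rewrite intree_rcons vw ltn_ord.
  by case.
- by move=> i; rewrite lee_fin.
- move=> i ni; rewrite indicE memNset// /type_event/= intree_rcons vw/=.
  by rewrite ltnNge ni => -[].
Qed.

Lemma typed_count_event v A n : measurable A ->
  typed (size v).+1 (count_event v A n).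
Proof.
move=> mA.
have -> : count_event v A n = vertex_event v `&`
    (children_in v A @^-1` [set n%:R%:E]).
  by apply/seteqP; split => w [vw] /= h; split => //;
    rewrite -h (offspring_pmE _ vw).
have m1 : measurable (vertex_event v : set (typedType (size v).+1)).
  exact: typed_vertex_event.
suff mc : measurable_fun [set: typedType (size v).+1] (children_in v A).
  have m2 : measurable
      (children_in v A @^-1` [set n%:R%:E] : set (typedType (size v).+1)).
    by rewrite -[X in measurable X]setTI; apply: mc.
  exact: measurableI m1 m2.
apply: (@ge0_emeasurable_sum _ (typedType (size v).+1)) => // i _.
apply/measurable_EFinP/measurable_indic.
by apply: typed_type_event => //; rewrite size_rcons.
Qed.

Definition poisson_weight v (A : set (borel T)) n w : \bar R :=
  if intree X v w
  then poisson_prob (fine (intensity (vtype X v w) A)) 0 [set n] else 0%E.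

Lemma poisson_weight_ge0 v A n w : (0 <= poisson_weight v A n w)%E.
Proof. by rewrite /poisson_weight; case: ifP. Qed.

Lemma measurable_poisson_weight v A n : measurable A ->
  measurable_fun [set: typedType (size v)] (poisson_weight v A n).
Proof.
move=> mA; apply: (measurable_fun_type (g := fun s =>
   poisson_prob (fine (intensity s A)) 0 [set n])) => //.
under eq_fun do rewrite poisson_prob1E.
apply/measurable_EFinP.
apply: (@measurableT_comp _ _ _ _ _ _ (fun r : R =>
  if 0 < r then poisson_pmf r n else (n == 0%N)%:R)); last first.
  exact: measurable_intensity.
apply: measurable_fun_ifT => //; first exact: measurable_fun_ltr.
exact: measurable_poisson_pmf.
Qed.


(** The defining property of the offspring point measures, for one vertex and
one Borel set. *)
Lemma count_given_typed_tree v A n G : measurable A -> typed (size v) G ->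
  P (G `&` count_event v A n) = (\int[P]_(w in G) poisson_weight v A n w)%E.
Proof.
move=> mA FG.
(* A family of disjoint sets indexed by all j, of which only j = 0 is tested. *)
pose Aj (_ : seq nat) j : set (borel T) := if j is 0%N then A else set0.
have sv u : u \in [:: v] -> size u = size v by rewrite inE => /eqP ->.
have mAj u j : measurable (Aj u j).
  by case: j => [|j]; [exact: mA|exact: measurable0].
have tAj u : trivIset setT (Aj u) by move=> [|i] [|j] _ _ //= [x []].
have uv : uniq [:: v] by [].
have /= := kbp_poisson X_kbp 1 (fun _ _ => n) uv sv mAj tAj FG.
move=> H; have -> : G `&` count_event v A n =
  (G `&` [set w | forall u, u \in [:: v] -> intree X u w]) `&`
   [set w | forall u j, u \in [:: v] -> (j < 1)%N ->
       offspring_pm X u w (Aj u j) = n%:R%:E].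
  apply/seteqP; split => w /=.
    move=> [Gw [vw cw]]; split; first by split => // u; rewrite inE => /eqP ->.
    by move=> u [|j]//; rewrite inE => /eqP ->.
  move=> [[Gw vw] cw]; split => //; split; first by apply: vw; rewrite inE.
  by apply: (cw v 0%N) => //; rewrite inE.
rewrite H integral_mkcond [RHS]integral_mkcond; apply: eq_integral => w _.
rewrite !patchE big_seq1 big_ord1 /poisson_weight.
have [Gw|nGw] := boolP (w \in G); last first.
  by case: ifPn => //; rewrite inE => -[Gw _]; rewrite notin_setE in nGw.
rewrite inE in Gw; case: ifPn => [|nv]; rewrite ?inE.
  by move=> [_ vw]; rewrite vw// inE.
case: ifPn => // vw; case/negP: nv; rewrite inE; split => // u.
by rewrite inE => /eqP ->.
Qed.

Definition exposure_event (es : seq (seq nat * nat))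
    (B : seq nat * nat -> set (measurableTypeR R)) : set Omega :=
  [set w | forall e, e \in es ->
     intree X (rcons e.1 e.2) w /\ B e (exposure X e.1 e.2 w)].

(** The conditional probability of [exposure_event es B] given the typed tree.
The factor 0 for an edge outside the tree matches the requirement of
[exposure_event] that all the edges of [es] belong to it. *)
Definition mark_weight (es : seq (seq nat * nat))
    (B : seq nat * nat -> set (measurableTypeR R)) w : \bar R :=
  (\prod_(e <- es) if intree X (rcons e.1 e.2) w
     then KE (vtype X e.1 w, vtype X (rcons e.1 e.2) w) (B e) else 0)%E.

Lemma mark_weight_ge0 es B w : (0 <= mark_weight es B w)%E.
Proof. by apply: prode_ge0 => e _; case: ifP. Qed.

Lemma exposure_given_typed_tree es B G :
  uniq es -> (forall e, measurable (B e)) ->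
  <<s \bigcup_r typed_tree_events X r >> G ->
  P (G `&` exposure_event es B) = (\int[P]_(w in G) mark_weight es B w)%E.
Proof.
move=> ues mB FG.
have /= H := @kbp_marks _ _ _ _ _ _ _ _ _ _ _ X_kbp [::] es (fun _ => setT) B G
  isT ues (fun=> measurableT) mB FG.
have -> : G `&` exposure_event es B =
  G `&` [set w | forall v, v \in [::] -> intree X v w]
    `&` [set w | forall e, e \in es -> intree X (rcons e.1 e.2) w]
    `&` [set w | forall v, v \in [::] -> setT (shock X v w, resp X v w)]
    `&` [set w | forall e, e \in es -> B e (exposure X e.1 e.2 w)].
  apply/seteqP; split => w /=.
    move=> [Gw ew]; split; last by move=> e /ew[].
    by split => //; split => // e /ew[].
  move=> [[[[Gw _] tw] _] ew]; split => // e ees.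
  by split; [exact: tw|exact: ew].
rewrite H integral_mkcond [RHS]integral_mkcond; apply: eq_integral => w _.
rewrite !patchE big_nil mul1e /mark_weight.
have [Gw|nGw] := boolP (w \in G); last first.
  by case: ifPn => //; rewrite inE => -[[Gw _]]; rewrite notin_setE in nGw.
rewrite inE in Gw; case: ifPn => [|nes]; rewrite ?inE.
  move=> [_ ew]; rewrite big_seq [RHS]big_seq; apply: eq_bigr => e /ew.
  by move=> /= ->.
have [e ees ne] : exists2 e, e \in es & ~~ intree X (rcons e.1 e.2) w.
  apply: contrapT => ne; case/negP: nes; rewrite inE; split; first by split.
  move=> e ees /=; apply: contrapT => ne'; apply: ne.
  by exists e => //; exact/negP.
by apply/esym; rewrite (big_rem e ees)/= (negbTE ne) mul0e.
Qed.

Lemma measurable_mark_weight r es B :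
  (forall e, e \in es -> (size e.1 < r)%N) -> (forall e, measurable (B e)) ->
  measurable_fun [set: typedType r] (mark_weight es B).
Proof.
move=> + mB; rewrite /mark_weight; elim: es => [|e es ih] esr.
  by under eq_fun do rewrite big_nil; exact: measurable_cst.
under eq_fun do rewrite big_cons.
apply: emeasurable_funM; last first.
  by apply: ih => e' e'es; apply: esr; rewrite inE e'es orbT.
have er : (size e.1 < r)%N by apply: esr; rewrite inE eqxx.
set u := rcons e.1 e.2.
have ur : (size u <= r)%N by rewrite size_rcons.
pose tau v (w : typedType r) : borel T :=
  if intree X v w then vtype X v w else point.
have mtau v : (size v <= r)%N -> measurable_fun [set: typedType r] (tau v).
  by move=> vr; exact: (measurable_fun_type (g := id)).
rewrite (_ : (fun _ => _) = (fun w : typedType r =>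
  KE (tau e.1 w, tau u w) (B e) * (\1_(vertex_event u) w)%:E)%E); last first.
  apply/funext => w; rewrite /tau indicE /vertex_event.
  have [uw|nuw] := boolP (intree X u w); last first.
    by rewrite memNset ?mule0//=; exact/negP.
  rewrite mem_set// mule1; have := uw; rewrite /u intree_rcons => /andP[-> _].
  by [].
apply: emeasurable_funM; last first.
  by apply/measurable_EFinP/measurable_indic; exact: typed_vertex_event.
apply: (measurableT_comp (measurable_kernel KE (B e) (mB e))).
by apply: measurable_fun_pair; apply: mtau => //; exact: ltnW.
Qed.

(** A pi-system generating what is known once the tree has been explored through
generation [r]: the types, and the exposures of the edges between generations up
to [r].  The edges of [es] are required to belong to the tree, since the marks
have a prescribed law only there. *)
Definition revealed r : set (set Omega) :=
  [set E | exists G es B, [/\ typed r G, uniq es,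
     forall e, e \in es -> (size e.1 < r)%N, forall e, measurable (B e) &
     E = G `&` exposure_event es B]].

Local Notation revealedType r := (g_sigma_algebraType (revealed r)).

Lemma measurable_exposure_event es B : (forall e, measurable (B e)) ->
  measurable (exposure_event es B).
Proof.
move=> mB; elim: es => [|e es ih].
  by rewrite (_ : exposure_event _ _ = setT)//; apply/seteqP; split.
rewrite (_ : exposure_event _ _ = (vertex_event (rcons e.1 e.2) `&`
    exposure X e.1 e.2 @^-1` B e) `&` exposure_event es B).
  apply: measurableI => //; apply: measurableI.
    exact: measurable_vertex_event.
  by rewrite -[X in measurable X]setTI; exact: (kbp_exposure_meas X_kbp).
apply/seteqP; split => w /=.
  move=> ew; split; first by apply: ew; rewrite inE eqxx.
  by move=> e' e'es; apply: ew; rewrite inE e'es orbT.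
by move=> [ew esw] e'; rewrite inE => /predU1P[->//|]; exact: esw.
Qed.

Lemma revealed_measurable r : <<s revealed r >> `<=` measurable.
Proof.
apply: smallest_sub; first exact: sigma_algebra_measurable.
move=> _ [G [es [B [FG _ _ mB ->]]]].
apply: measurableI; first exact: typed_measurable FG.
exact: measurable_exposure_event.
Qed.

Lemma measurable_id_revealed r :
  measurable_fun [set: Omega] (id : Omega -> revealedType r).
Proof. by move=> _ A mA; rewrite setTI; exact: revealed_measurable mA. Qed.

Lemma revealed_setI_closed r : setI_closed (revealed r).
Proof.
move=> _ _ [G [es [B [FG ues esr mB ->]]]]
  [G' [es' [B' [FG' ues' esr' mB' ->]]]].
exists (G `&` G'), (undup (es ++ es')),
  (fun e => (if e \in es then B e else setT) `&`
            (if e \in es' then B' e else setT)); split.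
- exact: (@measurableI _ (typedType r)).
- exact: undup_uniq.
- by move=> e; rewrite mem_undup mem_cat => /orP[/esr|/esr'].
- by move=> e; apply: measurableI; case: ifP => // _; exact: measurableT.
- apply/seteqP; split => w /=.
    move=> [[Gw ew] [G'w e'w]]; split => // e; rewrite mem_undup mem_cat => ees.
    split; first by case/orP: ees => [/ew[]|/e'w[]].
    by split; case: ifP => //; [move=> /ew[]|move=> /e'w[]].
  move=> [[Gw G'w] ew]; split; split => // e ees.
    have /ew[-> []] : e \in undup (es ++ es') by rewrite mem_undup mem_cat ees.
    by rewrite ees.
  have /ew[-> [_]] : e \in undup (es ++ es').
    by rewrite mem_undup mem_cat ees orbT.
  by rewrite ees.
Qed.

Let P_lty (E : set Omega) (mE : measurable E) : (P E < +oo)%E.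
Proof. by rewrite (le_lt_trans (probability_le1 P mE)) ?ltry. Qed.

Lemma measurable_fun_typed d' (Y : measurableType d') r (g : Omega -> Y) :
  measurable_fun [set: typedType r] g -> measurable_fun [set: Omega] g.
Proof.
by move=> mg; apply: (measurableT_comp mg); exact: measurable_id_typed.
Qed.

Lemma measurable_fun_revealed d' (Y : measurableType d') r (g : Omega -> Y) :
  measurable_fun [set: revealedType r] g -> measurable_fun [set: Omega] g.
Proof.
by move=> mg; apply: (measurableT_comp mg); exact: measurable_id_revealed.
Qed.

(** Two exchanges of a conditional probability with its event. The exposures
are integrated out first, given the whole typed tree, which contains the event
[count_event v A n] of generation [size v + 1]; what remains is a function of
the tree through generation [size v], against which that event can be replaced
by its Poisson probability. Putting the exposures back gives the claim. *)
Lemma count_given_generator v A n G es B : measurable A ->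
  typed (size v) G -> uniq es ->
  (forall e, e \in es -> (size e.1 < size v)%N) ->
  (forall e, measurable (B e)) ->
  let E := G `&` exposure_event es B in
  P (E `&` count_event v A n) = (\int[P]_(w in E) poisson_weight v A n w)%E.
Proof.
move=> mA FG ues esr mB E.
set D := exposure_event es B in E *; set Q := count_event v A n.
set p := poisson_weight v A n; set rho := mark_weight es B.
have mG : measurable G by exact: typed_measurable FG.
have mD : measurable D by exact: measurable_exposure_event.
have mQ : measurable Q by apply: typed_measurable; exact: typed_count_event.
have mp : measurable_fun [set: typedType (size v)] p.
  exact: measurable_poisson_weight.
have mrho : measurable_fun [set: typedType (size v)] rho.
  exact: measurable_mark_weight.
have p0 w : (0 <= p w)%E by exact: poisson_weight_ge0.
have rho0 w : (0 <= rho w)%E by exact: mark_weight_ge0.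
have indic0 (A' : set Omega) w : (0 <= (\1_A' w)%:E :> \bar R)%E.
  by rewrite lee_fin.
have mG1 : measurable_fun [set: typedType (size v)]
    (fun w => (\1_G w)%:E : \bar R).
  by apply/measurable_EFinP/measurable_indic.
have restr (g : Omega -> \bar R) (A' : set Omega) :
    (\int[P]_(w in A') g w = \int[P]_w ((\1_A' w)%:E * g w))%E.
  rewrite integral_mkcond; apply: eq_integral => w _; rewrite patchE indicE.
  by case: ifP; rewrite ?mul1e ?mul0e.
have -> : P (E `&` Q) = (\int[P]_w (((\1_G w)%:E * rho w) * (\1_Q w)%:E))%E.
  rewrite (_ : E `&` Q = (G `&` Q) `&` D); last by rewrite setIAC.
  rewrite exposure_given_typed_tree//; last first.
    apply: (@measurableI _
      (g_sigma_algebraType (\bigcup_r typed_tree_events X r))).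
      exact: typed_bigcup FG.
    by apply: (@typed_bigcup (size v).+1); exact: typed_count_event.
  rewrite restr; apply: eq_integral => w _.
  by rewrite indicI /= EFinM muleAC.
have mid := @measurable_id_typed (size v).
transitivity (\int[P]_w (((\1_G w)%:E * rho w) * p w))%E.
  apply: (eq_integral_comp_mul mid _ _ (fun w => (\1_G w)%:E * rho w)%E) => //.
  - by apply/measurable_EFinP/measurable_indic.
  - exact: measurable_fun_typed mp.
  - exact: emeasurable_funM.
  - by move=> w; rewrite mule_ge0.
  - move=> A' mA'; rewrite integral_indic//; last exact: typed_measurable mA'.
    by rewrite setIC; exact: count_given_typed_tree.
transitivity (\int[P]_w (((\1_G w)%:E * p w) * rho w))%E.
  by apply: eq_integral => w _; rewrite muleAC.
transitivity (\int[P]_w (((\1_G w)%:E * p w) * (\1_D w)%:E))%E.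
  apply/esym.
  apply: (eq_integral_comp_mul mid _ _ (fun w => (\1_G w)%:E * p w)%E) => //.
  - by apply/measurable_EFinP/measurable_indic.
  - exact: measurable_fun_typed mrho.
  - exact: emeasurable_funM.
  - by move=> w; rewrite mule_ge0.
  - move=> A' mA'; rewrite integral_indic//; last exact: typed_measurable mA'.
    rewrite setIC; apply: exposure_given_typed_tree => //.
    exact: typed_bigcup mA'.
rewrite [RHS]restr; apply: eq_integral => w _.
by rewrite /E indicI /= EFinM muleAC.
Qed.

(** Both sides are finite measures in [E] and agree on the pi-system
[revealed], so they agree on the sigma-algebra that it generates. *)
Lemma count_given_revealed v A n E : measurable A ->
  <<s revealed (size v) >> E ->
  P (E `&` count_event v A n) = (\int[P]_(w in E) poisson_weight v A n w)%E.
Proof.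
move=> mA.
set Q := count_event v A n; set p := poisson_weight v A n.
have mQ : measurable Q by apply: typed_measurable; exact: typed_count_event.
have mp : measurable_fun [set: Omega] p.
  by apply: measurable_fun_typed; exact: measurable_poisson_weight.
have p0 w : (0 <= p w)%E by exact: poisson_weight_ge0.
have PT : P Q = (\int[P]_w p w)%E.
  by rewrite -(count_given_typed_tree (v := v) n mA (G := setT)) ?setTI//;
    exact: (@measurableT _ (typedType (size v))).
apply: (@dynkin_induction _ (revealedType (size v)) (revealed (size v))
  (fun E => P (E `&` Q) = (\int[P]_(w in E) p w)%E)) => //.
- exact: revealed_setI_closed.
- by rewrite setTI.
- move=> _ [G [es [B [FG ues esr mB ->]]]].
  exact: count_given_generator.
- move=> S mS /= PS.
  have mS' : measurable (S : set Omega) by exact: revealed_measurable mS.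
  have finS : P (S `&` Q) \is a fin_num.
    by rewrite ge0_fin_numE// P_lty//; exact: measurableI.
  have : (P (S `&` Q) + P (~` S `&` Q) =
      P (S `&` Q) + \int[P]_(w in ~` (S : set Omega)) p w)%E.
    rewrite {2}PS -measureU//=; last 3 first.
    - exact: measurableI.
    - by apply: measurableI => //; exact: measurableC.
    - by rewrite setIACA setICr set0I.
    rewrite -setIUl setUv setTI PT -ge0_integral_setU//.
    - by rewrite setUv.
    - exact: measurableC.
    - exact: measurable_funTS.
    - by apply/disj_setPS; rewrite setICr.
  rewrite ![(P (S `&` Q) + _)%E]addeC.
  by move/(congr1 (fun z => z - P (S `&` Q))%E); rewrite !addeK.
- move=> F mF tF PF /=.
  have mF' k : measurable (F k : set Omega).
    exact: revealed_measurable (mF k).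
  rewrite ge0_integral_bigcup//; last exact: measurable_funTS.
  rewrite setI_bigcupl measure_bigcup//.
  - rewrite (_ : (\sum_(i <oo | i \in setT) _ = \sum_(i <oo) P (F i `&` Q))%E).
      by apply: eq_eseriesr => k _; exact: PF.
    by apply: eq_eseriesl => k; exact: mem_set.
  - by move=> k _; exact: measurableI.
  - exact: trivIset_setIr.
Qed.


Definition parent_event v : set Omega :=
  [set w | intree X v w /\ (0 < offspring X v w)%N].

Lemma measurable_parent_event v : measurable (parent_event v).
Proof.
apply: measurableI; first exact: measurable_vertex_event.
rewrite -[X in measurable X]setTI.
exact: (kbp_offspring_meas X_kbp v measurableT (Y := [set n | (0 < n)%N])).
Qed.

Lemma offspring_pm_setT v w :
  offspring_pm X v w setT = (offspring X v w)%:R%:E.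
Proof.
rewrite /offspring_pm (eq_bigr (fun=> 1%E)) => [|i _]; last first.
  by rewrite diracE in_setT.
by rewrite sumEFin sumr_const card_ord.
Qed.

(** Being childless is [count_event v setT 0], of conditional probability
[exp(- Lambda_(tau_v)(T))], and [Lambda_(tau_v)(T) <= kbar]. *)
Lemma parent_given_revealed v E : <<s revealed (size v) >> E ->
  (P (E `&` parent_event v) <=
   (1 - expR (- kbar))%:E * P (E `&` vertex_event v))%E.
Proof.
move=> FE; have mE : measurable E by exact: revealed_measurable FE.
have mV := measurable_vertex_event v; have mA := measurable_parent_event v.
set C := count_event v setT 0.
have mC : measurable C by apply: typed_measurable; exact: typed_count_event.
have mEV := measurableI _ _ mE mV.
have mEA := measurableI _ _ mE mA.
have mEC := measurableI _ _ mE mC.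
have EV : P (E `&` vertex_event v) =
    (P (E `&` parent_event v) + P (E `&` C))%E.
  rewrite -measureU//.
    congr (P _); rewrite -setIUr; congr (_ `&` _); apply/seteqP; split => w /=.
      move=> vw; rewrite /C /count_event/= offspring_pm_setT.
      have [->|] := posnP (offspring X v w); first by right.
      by left.
    by case=> -[].
  apply/seteqP; split => // w /= [[_ [_ n0]] [_ [_]]].
  rewrite offspring_pm_setT => -[] /eqP; rewrite pnatr_eq0 => /eqP n0'.
  by rewrite n0' in n0.
have Ck : ((expR (- kbar))%:E * P (E `&` vertex_event v) <= P (E `&` C))%E.
  have mI : measurable_fun [set: Omega]
      (fun w => (\1_(E `&` vertex_event v) w)%:E : \bar R).
    exact/measurable_EFinP/measurable_indic.
  rewrite count_given_revealed// [leRHS]integral_mkcond.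
  rewrite -[X in (_ * P X)%E]setIT -integral_indic// -ge0_integralZl_EFin//.
  apply: ge0_le_integral => //.
  - exact: emeasurable_funM.
  - apply/(measurable_restrictT _ mE)/measurable_funTS.
    by apply: measurable_fun_typed; exact: measurable_poisson_weight.
  move=> w _; rewrite patchE indicE in_setI.
  have [Ew|_] /= := boolP (w \in E); last by rewrite mule0.
  rewrite /poisson_weight; case: ifPn => vw; last first.
    by rewrite memNset ?mule0//; exact/negP.
  rewrite mem_set// mule1 poisson_prob_eq0; last first.
    by rewrite fine_ge0// intensity_ge0.
  rewrite lee_fin ler_expR lerN2 -lee_fin fineK; last first.
    by apply: (intensity_fin_num mu kappa_ge0 kappa_continuous kappa_bounded);
      exact: measurableT.
  apply: le_trans
    (intensity_le mu kappa_ge0 kappa_continuous kappa_bounded _ _) _ => //.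
  by rewrite probability_setT mule1.
have /fineK fA : P (E `&` parent_event v) \is a fin_num.
  by rewrite ge0_fin_numE ?P_lty.
have /fineK fC : P (E `&` C) \is a fin_num by rewrite ge0_fin_numE ?P_lty.
move: Ck; rewrite EV -fA -fC -!EFinD -!EFinM !lee_fin.
by move: (fine _) (fine _) => a c; nra.
Qed.

Lemma children_in_le v A w : measurable A ->
  (children_in v A w <= \sum_(n <oo) (n%:R * \1_(count_event v A n) w)%:E)%E.
Proof.
move=> mA.
have pos n : (0 <= (n%:R * \1_(count_event v A n) w : R)%:E)%E.
  by rewrite lee_fin.
have [vw|nvw] := boolP (intree X v w); last first.
  rewrite /children_in eseries0; first exact: nneseries_ge0.
  move=> i _ _; rewrite indicE memNset// /type_event/=.
  by rewrite intree_rcons (negbTE nvw); case.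
have [m cm] : exists m : nat, offspring_pm X v w A = m%:R%:E.
  exists (\sum_(i < offspring X v w) (vtype X (rcons v i) w \in A))%N.
  rewrite /offspring_pm natr_sum -sumEFin; apply: eq_bigr => i _.
  by rewrite diracE.
rewrite -(offspring_pmE _ vw) cm (nneseries_split 0 m.+1)// big_nat_recr//=.
rewrite (_ : (m%:R * _)%:E = m%:R%:E); last by rewrite indicE mem_set ?mulr1.
rewrite -addeA addeC -addeA leeDl// adde_ge0//; first exact: nneseries_ge0.
by apply: sume_ge0 => *; rewrite lee_fin.
Qed.

(** The mean of the Poisson law, as an upper bound: [Lambda_s(A) <= kbar * mu
A]. *)
Lemma children_given_revealed v A E :
  measurable A -> <<s revealed (size v) >> E ->
  (\int[P]_(w in E) children_in v A w <=
   kbar%:E * mu A * P (E `&` vertex_event v))%E.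
Proof.
move=> mA FE; have mE : measurable E by exact: revealed_measurable FE.
have mV := measurable_vertex_event v.
have mC n : measurable (count_event v A n).
  by apply: typed_measurable; exact: typed_count_event.
have pos n w : (0 <= (n%:R * \1_(count_event v A n) w : R)%:E)%E.
  by rewrite lee_fin.
have mpos n : measurable_fun E
    (fun w => (n%:R * \1_(count_event v A n) w : R)%:E).
  by apply/measurable_EFinP/measurable_funM => //; exact: measurable_indic.
have mpw n : measurable_fun E (poisson_weight v A n).
  apply: measurable_funTS; apply: measurable_fun_typed.
  exact: measurable_poisson_weight.
apply: (@le_trans _ _ (\int[P]_(w in E)
    \sum_(n <oo) (n%:R * \1_(count_event v A n) w)%:E)%E).
  apply: ge0_le_integral => //.
  - by move=> w _; apply: nneseries_ge0 => *; rewrite lee_fin.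
  - apply: measurable_funTS; apply: ge0_emeasurable_sum => // i _.
    by apply/measurable_EFinP/measurable_indic; exact: measurable_type_event.
  - by apply: ge0_emeasurable_sum => // i _ *.
  - by move=> w _; exact: children_in_le.
have cnt n : (\int[P]_(w in E) (\1_(count_event v A n) w)%:E =
    \int[P]_(w in E) poisson_weight v A n w)%E.
  by rewrite integral_indic// setIC; exact: count_given_revealed.
rewrite integral_nneseries//.
under eq_eseriesr => n _.
  under eq_integral do rewrite EFinM.
  rewrite ge0_integralZl_EFin//; last exact: measurable_EFin_indic.
  rewrite cnt.
  rewrite -ge0_integralZl_EFin//; last by move=> w _; exact: poisson_weight_ge0.
  over.
have pw0 n w : (0 <= n%:R%:E * poisson_weight v A n w)%E.
  by rewrite mule_ge0 ?poisson_weight_ge0// lee_fin.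
rewrite -integral_nneseries//; last first.
  by move=> n; exact: emeasurable_funM.
have mIV : measurable_fun E (fun w => (\1_(vertex_event v) w)%:E : \bar R).
  by apply/measurable_EFinP; exact: measurable_indic.
rewrite -[X in P X]setIC -integral_indic// -ge0_integralZl//; last first.
  by rewrite mule_ge0// lee_fin (kbar_ge0 kappa_bounded).
apply: ge0_le_integral => //.
- by move=> w _; apply: nneseries_ge0.
- by apply: ge0_emeasurable_sum => // n _; exact: emeasurable_funM.
- exact: emeasurable_funM.
move=> w _; rewrite indicE; have [vw|nvw] := boolP (intree X v w); last first.
  rewrite memNset ?mule0; last exact/negP.
  by rewrite eseries0// => n _ _; rewrite /poisson_weight (negbTE nvw) mule0.
rewrite /poisson_weight vw.
rewrite mem_set// mule1; apply: le_trans (poisson_mean_le _) _.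
  by rewrite fine_ge0// intensity_ge0.
rewrite fineK; first exact: (intensity_le mu kappa_ge0).
exact: (intensity_fin_num mu kappa_ge0 kappa_continuous kappa_bounded).
Qed.


(** The integral of [B] against the offspring point measure of [v]. *)
Definition children_sum v (B : borel T -> \bar R) w : \bar R :=
  (\sum_(i <oo) if intree X (rcons v i) w
                then B (vtype X (rcons v i) w) else 0)%E.

Lemma measurable_child_value (B : borel T -> \bar R) v :
  measurable_fun [set: borel T] B ->
  measurable_fun [set: Omega]
    (fun w => if intree X v w then B (vtype X v w) else 0%E).
Proof.
move=> mB; apply: (@measurable_fun_typed _ _ (size v)).
exact: measurable_fun_type.
Qed.

(** On [E], the mean number of children with type in [A] is a measure in [A];
by [children_given_revealed] it is dominated by a multiple of [mu], so the
integrals of [B] compare in the same way. *)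
Lemma children_sum_given_revealed v (B : borel T -> \bar R) E :
  measurable_fun [set: borel T] B -> (forall t, 0 <= B t)%E ->
  <<s revealed (size v) >> E ->
  (\int[P]_(w in E) children_sum v B w <=
   kbar%:E * \int[mu]_t B t * P (E `&` vertex_event v))%E.
Proof.
move=> mB B0 FE; have mE : measurable E by exact: revealed_measurable FE.
have mV := measurable_vertex_event.
have mEV := measurableI _ _ mE (mV v).
have k0 := kbar_ge0 kappa_bounded.
have c0 : 0 <= kbar * fine (P (E `&` vertex_event v)).
  by rewrite mulr_ge0// fine_ge0.
pose c : {nonneg R} := NngNum c0.
have cE : (c%:num)%:E = (kbar%:E * P (E `&` vertex_event v))%E.
  by rewrite /= EFinM fineK// ge0_fin_numE// P_lty.
pose D i := E `&` vertex_event (rcons v i).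
have mD i : measurable (D i) by exact: measurableI.
have mg i : measurable_fun [set: Omega] (fun w => (\1_(D i) w)%:E : \bar R).
  exact/measurable_EFinP/measurable_indic.
have g0 i w : (0 <= (\1_(D i) w)%:E :> \bar R)%E by rewrite lee_fin.
have mtau i := kbp_vtype_meas X_kbp (rcons v i).
pose nu i : {measure set (borel T) -> \bar R} :=
  measure_function_pushforward__canonical__measure_function_Measure
    (density P (mg i) (g0 i)) (mtau i).
have nuE i A : measurable A ->
    nu i A = (\int[P]_(w in E) (\1_(type_event (rcons v i) A) w)%:E)%E.
  move=> mA; rewrite integral_indic//; last exact: measurable_type_event.
  rewrite /nu /= /pushforward /density integral_indic//; last first.
    by rewrite -[X in measurable X]setTI; exact: (mtau i measurableT A mA).
  by congr (P _); apply/seteqP; split => w /= [] // [? ?] ?.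
have le_nu A : measurable A -> (mseries nu 0 A <= mscale c mu A)%E.
  move=> mA; rewrite /mseries /mscale/= -/(c%:num) cE muleAC.
  apply: le_trans (children_given_revealed mA FE).
  rewrite integral_nneseries//; last first.
    by move=> i; apply/measurable_EFinP/measurable_indic/measurable_type_event.
  apply: lee_nneseries => [i _ _|i _]; first exact: (measure_ge0 (nu i)).
  by rewrite -(nuE i A mA).
(* [nu i] is the law of the type of the i-th child on [E], so the series of the
   [nu i] is the mean offspring measure. *)
have -> : (\int[P]_(w in E) children_sum v B w = \int[mseries nu 0]_t B t)%E.
  rewrite ge0_integral_measure_series// integral_nneseries//; last 2 first.
  - by move=> i; apply: measurable_funTS; exact: measurable_child_value.
  - by move=> i w _; case: ifP.
  apply: eq_eseriesr => i _; rewrite /nu/= ge0_integral_pushforward//=.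
  rewrite preimage_setT ge0_integral_density//; last first.
    exact: (measurableT_comp mB (mtau i)).
  rewrite [LHS]integral_mkcond; apply: eq_integral => w _.
  rewrite patchE indicE in_setI.
  have [Ew|_]/= := boolP (w \in E); last by rewrite mule0.
  case: ifPn => vw; first by rewrite mem_set// mule1.
  by rewrite memNset ?mule0//; exact/negP.
rewrite muleAC -cE -ge0_integral_mscale//.
by apply: ge0_le_measure_integral.
Qed.


(** * Mean mass transported down the tree *)

(** The absolute value and the default 0 make the weights below nonnegative and
substochastic for every outcome; they agree with [exposure] and [weight] on the
edges of the tree as soon as the exposures are positive, hence almost surely. *)
Definition tree_exposure v i w : R :=
  if intree X (rcons v i) w then `|exposure X v i w| else 0.

Definition total_exposure v w : R :=
  fine (\sum_(i <oo) (tree_exposure v i w)%:E)%E.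

Definition tree_weight v i w : R := tree_exposure v i w / total_exposure v w.

Definition path_weight v w : R :=
  \prod_(j < size v) tree_weight (take j v) (nth 0%N v j) w.

Lemma tree_exposure_ge0 v i w : 0 <= tree_exposure v i w.
Proof. by rewrite /tree_exposure; case: ifP. Qed.

Lemma total_exposureE v w :
  total_exposure v w = \sum_(i < offspring X v w) tree_exposure v i w.
Proof.
rewrite /total_exposure (@nneseries_finite_support _ _ (offspring X v w)).
- by rewrite sumEFin.
- by move=> i; rewrite lee_fin tree_exposure_ge0.
- by move=> i ni; rewrite /tree_exposure intree_rcons ltnNge ni andbF.
Qed.

Lemma total_exposure_ge0 v w : 0 <= total_exposure v w.
Proof.
by rewrite total_exposureE sumr_ge0// => i _; exact: tree_exposure_ge0.
Qed.

Lemma tree_weight_ge0 v i w : 0 <= tree_weight v i w.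
Proof. by rewrite divr_ge0 ?tree_exposure_ge0 ?total_exposure_ge0. Qed.

Lemma tree_weight_out v i w :
  ~~ intree X (rcons v i) w -> tree_weight v i w = 0.
Proof.
by move=> nvi; rewrite /tree_weight /tree_exposure (negbTE nvi) mul0r.
Qed.

Lemma sum_tree_weight v w : \sum_(i < offspring X v w) tree_weight v i w <= 1.
Proof.
rewrite -mulr_suml -total_exposureE.
have [->|n0] := eqVneq (total_exposure v w) 0; first by rewrite mul0r.
by rewrite divff.
Qed.

Lemma nneseries_tree_weight_le v w :
  (\sum_(i <oo) (tree_weight v i w)%:E <= (\1_(parent_event v) w)%:E)%E.
Proof.
have [pw|npw] := pselect (parent_event v w).
  rewrite (@nneseries_finite_support _ _ (offspring X v w)).
  - by rewrite sumEFin lee_fin indicE mem_set ?sum_tree_weight.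
  - by move=> i; rewrite lee_fin tree_weight_ge0.
  - by move=> i ni; rewrite tree_weight_out// intree_rcons ltnNge ni andbF.
rewrite eseries0// => i _ _; rewrite tree_weight_out// intree_rcons.
by apply/negP => /andP[vw iN]; apply: npw; split => //; exact: leq_ltn_trans iN.
Qed.

Lemma tree_weight_le1 v i w : tree_weight v i w <= 1.
Proof.
have [iN|Ni] := ltnP i (offspring X v w); last first.
  by rewrite tree_weight_out ?ler01// intree_rcons ltnNge Ni andbF.
apply: le_trans (sum_tree_weight v w).
rewrite (bigD1 (Ordinal iN))//= lerDl sumr_ge0// => j _.
exact: tree_weight_ge0.
Qed.

Lemma path_weight_nil w : path_weight [::] w = 1.
Proof. by rewrite /path_weight big_ord0. Qed.

Lemma path_weight_rcons v i w :
  path_weight (rcons v i) w = path_weight v w * tree_weight v i w.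
Proof.
rewrite /path_weight size_rcons big_ord_recr/=; congr (_ * _); last first.
  by rewrite nth_rcons ltnn eqxx -cats1 take_size_cat.
apply: eq_bigr => j _; rewrite nth_rcons ltn_ord; congr (tree_weight _ _ _).
by rewrite -cats1 takel_cat// ltnW.
Qed.

Lemma path_weight_ge0 v w : 0 <= path_weight v w.
Proof. by apply: prodr_ge0 => j _; exact: tree_weight_ge0. Qed.

Lemma revealed_exposure_event r v i B : (size v < r)%N -> measurable B ->
  <<s revealed r >>
    [set w | intree X (rcons v i) w /\ B (exposure X v i w)].
Proof.
move=> vr mB; apply: sub_sigma_algebra.
exists setT, [:: (v, i)], (fun=> B); split => //.
- exact: (@measurableT _ (typedType r)).
- by move=> e; rewrite inE => /eqP ->.
- apply/seteqP; split => w /=.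
    by move=> vB; split => // e; rewrite inE => /eqP ->.
  by move=> [_ /(_ (v, i))]; rewrite inE; exact.
Qed.

Lemma measurable_tree_exposure r v i : (size v < r)%N ->
  measurable_fun [set: revealedType r] (tree_exposure v i).
Proof.
move=> vr; pose c (w : revealedType r) := if intree X (rcons v i) w
  then exposure X v i w else 0.
rewrite (_ : tree_exposure v i = Num.norm \o c); last first.
  by apply/funext => w; rewrite /tree_exposure /c/=; case: ifP; rewrite ?normr0.
apply: measurableT_comp; first exact: normr_measurable.
apply: (@measurable_fun_default _ _ (revealedType r)).
  rewrite (_ : [set _ | _] =
    [set w | intree X (rcons v i) w /\ setT (exposure X v i w)]).
    exact: revealed_exposure_event.
  by apply/seteqP; split => w //= [].
by move=> A mA; exact: revealed_exposure_event.
Qed.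

Lemma measurable_tree_weight r v i : (size v < r)%N ->
  measurable_fun [set: revealedType r] (tree_weight v i).
Proof.
move=> vr.
rewrite (_ : tree_weight v i = (fun w : revealedType r =>
    tree_exposure v i w * total_exposure v w `^ (-1))); last first.
  by apply/funext => w; rewrite powR_inv1// total_exposure_ge0.
apply: measurable_funM; first exact: measurable_tree_exposure.
apply: (measurableT_comp (measurable_powR (-1))).
apply: (measurableT_comp (fine_measurable measurableT)).
apply: ge0_emeasurable_sum => [k w _ _|k _].
  by rewrite lee_fin tree_exposure_ge0.
by apply/measurable_EFinP; exact: measurable_tree_exposure.
Qed.

Lemma measurable_path_weight v :
  measurable_fun [set: revealedType (size v)] (path_weight v).
Proof.
apply: measurable_prod => j _; apply: measurable_tree_weight.
by rewrite size_take ltn_ord.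
Qed.

Let mpath v : measurable_fun [set: Omega] (path_weight v).
Proof. exact: measurable_fun_revealed (measurable_path_weight (v:=v)). Qed.

(** One step of the exploration: the weights out of [v] add up to at most the
indicator that [v] has a child, and [path_weight v] is known before the children
of [v] are. *)
Lemma path_weight_survival v :
  (\sum_(i <oo) \int[P]_w (path_weight (rcons v i) w)%:E <=
   (1 - expR (- kbar))%:E * \int[P]_w (path_weight v w)%:E)%E.
Proof.
have q0 : 0 <= 1 - expR (- kbar).
  by rewrite subr_ge0 -expR0 ler_expR oppr_le0 (kbar_ge0 kappa_bounded).
have q0E w A : (0 <= (1 - expR (- kbar))%:E * (\1_A w)%:E :> \bar R)%E.
  by rewrite mule_ge0// lee_fin.
have mpar := measurable_parent_event v; have mver := measurable_vertex_event v.
have mpv : measurable_fun [set: Omega] (fun w => (path_weight v w)%:E).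
  by apply/measurable_EFinP.
have pv0 w : (0 <= (path_weight v w)%:E)%E by rewrite lee_fin path_weight_ge0.
rewrite -integral_nneseries//; last 2 first.
- by move=> i; exact/measurable_EFinP.
- by move=> i w _; rewrite lee_fin path_weight_ge0.
apply: (@le_trans _ _
    (\int[P]_w ((path_weight v w)%:E * (\1_(parent_event v) w)%:E))%E).
  apply: ge0_le_integral => //.
  - move=> w _; apply: nneseries_ge0 => i _ _.
    by rewrite lee_fin path_weight_ge0.
  - by apply: ge0_emeasurable_sum => [i w _ _|i _];
      [rewrite lee_fin path_weight_ge0|exact/measurable_EFinP].
  - by apply: emeasurable_funM => //; exact: measurable_EFin_indic.
  move=> w _; under eq_eseriesr => i _ do rewrite path_weight_rcons EFinM.
  rewrite nneseriesZl; last by move=> i _; rewrite lee_fin tree_weight_ge0.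
  by rewrite lee_wpmul2l// nneseries_tree_weight_le.
apply: (@le_trans _ _ (\int[P]_w ((path_weight v w)%:E *
    ((1 - expR (- kbar))%:E * (\1_(vertex_event v) w)%:E)))%E).
  apply: (le_integral_comp_mul (measurable_id_revealed (r:=size v)) _ _
    (fun w => (path_weight v w)%:E)) => //.
  - exact: measurable_EFin_indic.
  - by apply: emeasurable_funM => //; exact: measurable_EFin_indic.
  - by apply/measurable_EFinP; exact: measurable_path_weight.
  - move=> E mE; have mE' : measurable (E : set Omega).
      exact: revealed_measurable mE.
    rewrite ge0_integralZl_EFin//; last exact: measurable_EFin_indic.
    rewrite !integral_indic// (setIC (parent_event v)) (setIC (vertex_event v)).
    exact: (parent_given_revealed mE).
rewrite -ge0_integralZl_EFin//.
apply: ge0_le_integral => //.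
- by move=> w _; rewrite mule_ge0.
- do 2 apply: emeasurable_funM => //.
  exact: measurable_EFin_indic.
- exact: emeasurable_funM.
move=> w _; rewrite muleC lee_wpmul2r// -[leRHS]mule1 lee_wpmul2l//.
by rewrite lee_fin indicE lern1 leq_b1.
Qed.

(** The step to the last generation: the weights out of [v] are replaced by 1,
and the children are counted with their values under [B]. *)
Lemma path_weight_children (B : borel T -> \bar R) v :
  measurable_fun [set: borel T] B -> (forall t, 0 <= B t)%E ->
  (\sum_(i <oo) \int[P]_w ((path_weight (rcons v i) w)%:E *
      if intree X (rcons v i) w then B (vtype X (rcons v i) w) else 0) <=
   kbar%:E * \int[mu]_t B t * \int[P]_w (path_weight v w)%:E)%E.
Proof.
move=> mB B0.
have mver := measurable_vertex_event v.
have mpE u : measurable_fun [set: Omega] (fun w => (path_weight u w)%:E).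
  by apply/measurable_EFinP.
have p0 u w : (0 <= (path_weight u w)%:E)%E by rewrite lee_fin path_weight_ge0.
have mBv u := measurable_child_value u mB.
have B0v u w : (0 <= if intree X u w then B (vtype X u w) else 0)%E.
  by case: ifP.
have mch : measurable_fun [set: Omega] (children_sum v B).
  by apply: ge0_emeasurable_sum.
have ch0 w : (0 <= children_sum v B w)%E by apply: nneseries_ge0.
have c0 : (0 <= kbar%:E * \int[mu]_t B t)%E.
  rewrite mule_ge0// ?lee_fin ?(kbar_ge0 kappa_bounded)//.
  exact: integral_ge0.
rewrite -integral_nneseries//; last 2 first.
- by move=> i; exact: emeasurable_funM.
- by move=> i w _; rewrite mule_ge0.
apply: (@le_trans _ _
    (\int[P]_w ((path_weight v w)%:E * children_sum v B w))%E).
  apply: ge0_le_integral => //.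
  - by move=> w _; apply: nneseries_ge0 => i _ _; rewrite mule_ge0.
  - by apply: ge0_emeasurable_sum => [i w _ _|i _];
      [rewrite mule_ge0|exact: emeasurable_funM].
  - exact: emeasurable_funM.
  move=> w _; rewrite /children_sum -nneseriesZl//.
  apply: lee_nneseries => [i _ _|i _]; first by rewrite mule_ge0.
  rewrite lee_wpmul2r// lee_fin path_weight_rcons ler_piMr ?path_weight_ge0//.
  exact: tree_weight_le1.
apply: (@le_trans _ _ (\int[P]_w ((path_weight v w)%:E *
    (kbar%:E * \int[mu]_t B t * (\1_(vertex_event v) w)%:E)))%E).
  apply: (le_integral_comp_mul (measurable_id_revealed (r:=size v)) _ _
    (fun w => (path_weight v w)%:E)) => //.
  - by apply: emeasurable_funM => //; exact: measurable_EFin_indic.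
  - by move=> w; rewrite mule_ge0// lee_fin.
  - by apply/measurable_EFinP; exact: measurable_path_weight.
  - move=> E mE; have mE' : measurable (E : set Omega).
      exact: revealed_measurable mE.
    rewrite ge0_integralZl//; last exact: measurable_EFin_indic.
    rewrite integral_indic// (setIC (vertex_event v)).
    exact: (children_sum_given_revealed mB B0 mE).
move: (kbar%:E * \int[mu]_t B t)%E c0 => c c0.
rewrite -ge0_integralZl//.
apply: ge0_le_integral => //.
- by move=> w _; rewrite !mule_ge0// lee_fin.
- do 2 apply: emeasurable_funM => //.
  exact: measurable_EFin_indic.
- exact: emeasurable_funM.
move=> w _; rewrite muleC lee_wpmul2r// -[leRHS]mule1 lee_wpmul2l//.
by rewrite lee_fin indicE lern1 leq_b1.
Qed.


Lemma surviving_mass k :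
  (generation_sum k (fun v => \int[P]_w (path_weight v w)%:E) <=
   ((1 - expR (- kbar)) ^+ k)%:E)%E.
Proof.
have q0 : 0 <= 1 - expR (- kbar).
  by rewrite subr_ge0 -expR0 ler_expR oppr_le0 (kbar_ge0 kappa_bounded).
have I0 v : (0 <= \int[P]_w (path_weight v w)%:E)%E.
  by apply: integral_ge0 => w _; rewrite lee_fin path_weight_ge0.
elim: k => [|k ih] /=.
  under eq_integral do rewrite path_weight_nil.
  by rewrite integral_cst// mul1e expr0; exact: probability_le1.
apply: (@le_trans _ _ (generation_sum k (fun v =>
    (1 - expR (- kbar))%:E * \int[P]_w (path_weight v w)%:E))%E).
  apply: le_generation_sum => v; first exact: nneseries_ge0.
  exact: path_weight_survival.
by rewrite generation_sumZl// exprS EFinM lee_wpmul2l.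
Qed.

Definition weighted_mass (B : borel T -> \bar R) k w : \bar R :=
  generation_sum k (fun v => (path_weight v w)%:E *
    if intree X v w then B (vtype X v w) else 0)%E.

Section mean_decay.
Variable B : borel T -> \bar R.
Hypotheses (mB : measurable_fun [set: borel T] B) (B0 : forall t, (0 <= B t)%E).

Let mterm v : measurable_fun [set: Omega] (fun w => (path_weight v w)%:E *
    if intree X v w then B (vtype X v w) else 0)%E.
Proof.
apply: emeasurable_funM; first exact/measurable_EFinP.
exact: measurable_child_value.
Qed.

Let term_ge0 v w : (0 <= (path_weight v w)%:E *
    if intree X v w then B (vtype X v w) else 0)%E.
Proof. by rewrite mule_ge0 ?lee_fin ?path_weight_ge0//; case: ifP. Qed.

Lemma weighted_mass_ge0 k w : (0 <= weighted_mass B k w)%E.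
Proof. exact: generation_sum_ge0. Qed.

Lemma measurable_weighted_mass k :
  measurable_fun [set: Omega] (weighted_mass B k).
Proof. exact: measurable_generation_sum. Qed.

Lemma mean_weighted_mass_le k (c : R) : (\int[mu]_t B t = c%:E)%E ->
  (\int[P]_w weighted_mass B k.+1 w <=
   (kbar * c * (1 - expR (- kbar)) ^+ k)%:E)%E.
Proof.
move=> Bc; have k0 := kbar_ge0 kappa_bounded.
have c0 : 0 <= c by rewrite -lee_fin -Bc; exact: integral_ge0.
rewrite integral_generation_sum//=.
apply: (@le_trans _ _ (generation_sum k (fun v =>
    (kbar * c)%:E * \int[P]_w (path_weight v w)%:E))%E).
  apply: le_generation_sum => v.
    by apply: nneseries_ge0 => i _ _; exact: integral_ge0.
  by rewrite EFinM -Bc; exact: path_weight_children.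
rewrite generation_sumZl.
  by rewrite [leRHS]EFinM lee_wpmul2l ?lee_fin ?mulr_ge0// surviving_mass.
by move=> v; apply: integral_ge0 => w _; rewrite lee_fin path_weight_ge0.
Qed.

(** The means are summable, so the sum of the masses is almost surely finite. *)
Lemma ae_weighted_mass_cvg0 : mu.-integrable [set: borel T] B ->
  {ae P, forall w, weighted_mass B k w @[k --> \oo] --> 0%E}.
Proof.
move=> iB.
have Bfin : (\int[mu]_t B t)%E \is a fin_num by exact: integrable_fin_num.
pose c := fine (\int[mu]_t B t)%E.
have Bc : (\int[mu]_t B t = c%:E)%E by rewrite fineK.
have k0 := kbar_ge0 kappa_bounded.
have c0 : 0 <= c by rewrite fine_ge0//; exact: integral_ge0.
pose q := 1 - expR (- kbar).
have q0 : 0 <= q by rewrite subr_ge0 -expR0 ler_expR oppr_le0.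
have q1 : q < 1 by rewrite ltrBlDr ltrDl expR_gt0.
pose S w : \bar R := (\sum_(k <oo) weighted_mass B k.+1 w)%E.
have mS : measurable_fun [set: Omega] S.
  apply: ge0_emeasurable_sum => [k w _ _|k _]; first exact: weighted_mass_ge0.
  exact: measurable_weighted_mass.
have S0 w : (0 <= S w)%E by apply: nneseries_ge0 => *; exact: weighted_mass_ge0.
have iS : P.-integrable [set: Omega] S.
  apply/integrableP; split => //.
  under eq_integral do rewrite gee0_abs//.
  rewrite integral_nneseries//; last 2 first.
  - by move=> k; exact: measurable_weighted_mass.
  - by move=> *; exact: weighted_mass_ge0.
  apply: (@le_lt_trans _ _ (kbar * c / (1 - q))%:E); last exact: ltry.
  apply: lime_le.
    apply: is_cvg_nneseries => *; apply: integral_ge0 => *.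
    exact: weighted_mass_ge0.
  apply: nearW => n.
  apply: (@le_trans _ _ (\sum_(0 <= k < n) (kbar * c * q ^+ k)%:E)%E).
    by apply: lee_sum => k _; exact: mean_weighted_mass_le.
  rewrite sumEFin lee_fin.
  have kc0 : 0 <= kbar * c by rewrite mulr_ge0.
  have -> : \sum_(0 <= k < n) kbar * c * q ^+ k =
      kbar * c * (1 - q ^+ n) / (1 - q).
    exact: (congr1 (@^~ n) (geometric_seriesE (kbar * c) (negbT (lt_eqF q1)))).
  apply: ler_wpM2r; first by rewrite invr_ge0 subr_ge0 ltW.
  by rewrite ler_piMr// gerBl exprn_ge0.
have := integrable_ae measurableT iS; apply: filterS => w /(_ I) Sfin.
rewrite -cvg_shiftS.
have tail0 : (\sum_(N <= k <oo) weighted_mass B k.+1 w)%E @[N --> \oo] --> 0%E.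
  apply: nneseries_tail_cvg; last by move=> *; exact: weighted_mass_ge0.
  by rewrite -(ge0_fin_numE (S0 w)).
apply: (squeeze_cvge _ (cvg_cst 0%E) tail0); apply: nearW => N /=.
rewrite weighted_mass_ge0/=.
rewrite (nneseries_split N 1)//; last by move=> *; exact: weighted_mass_ge0.
rewrite addn1 big_nat1 leeDl// nneseries_ge0// => *.
exact: weighted_mass_ge0.
Qed.

End mean_decay.

(** * The gap between the extremal iterates *)

Section coalescence.
Hypothesis f_Fne : forall s, Fne (f s).

Definition regular_outcome w :=
  (forall v, intree X v w -> resp X v w = f (vtype X v w)) /\
  (forall v i, intree X (rcons v i) w -> 0 < exposure X v i w).

Definition deviation k v w := `|xplus X k v w - xminus X k v w|.

Lemma bsup_ge0 s : 0 <= bsup (f s).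
Proof.
have [bf f0 _ _] := f_Fne s.
apply: le_trans (f0 0) _; apply: ub_le_sup; last by exists 0.
exact: bounded_fun_has_ubound bf.
Qed.

Lemma weight_tree_weight w v i : regular_outcome w -> intree X v w ->
  (i < offspring X v w)%N -> weight X v i w = tree_weight v i w.
Proof.
move=> [_ Cpos] vw iN; rewrite /weight /tree_weight total_exposureE.
have tE j : (j < offspring X v w)%N -> tree_exposure v j w = exposure X v j w.
  move=> jN; have vj : intree X (rcons v j) w by rewrite intree_rcons vw.
  by rewrite /tree_exposure vj gtr0_norm// Cpos.
by rewrite tE//; congr (_ / _); apply: eq_bigr => j _; rewrite tE.
Qed.

Lemma deviation_contract w k v : regular_outcome w -> intree X v w ->
  deviation k.+1 v w <=
    \sum_(i < offspring X v w) tree_weight v i w * deviation k (rcons v i) w.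
Proof.
move=> reg vw; rewrite /deviation /xplus /xminus /= (reg.1 _ vw).
have [_ _ _ lip] := f_Fne (vtype X v w).
set a := (X in f _ X - _); set b := (X in _ - f _ X).
have /= := lip (a, b) (conj I I).
rewrite mul1r => /le_trans; apply.
rewrite /a /b opprD addrACA subrr addr0 -sumrB.
apply: le_trans (ler_norm_sum _ _ _) _.
apply: ler_sum => i _; rewrite -mulrBr normrM (weight_tree_weight reg vw)//.
by rewrite ger0_norm// tree_weight_ge0.
Qed.

(** Unrolling [deviation_contract] over [j] generations. *)
Lemma deviation_le_generation_sum w j k : regular_outcome w ->
  ((deviation (k + j) [::] w)%:E <= generation_sum j (fun v =>
     (path_weight v w)%:E *
     if intree X v w then (deviation k v w)%:E else 0))%E.
Proof.
move=> reg; elim: j k => [|j ih] k.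
  by rewrite addn0 /= path_weight_nil mul1e.
rewrite addnS -addSn; apply: le_trans (ih k.+1) _ => /=.
have t0 v : (0 <= (path_weight v w)%:E *
    (if intree X v w then (deviation k.+1 v w)%:E else 0))%E.
  rewrite mule_ge0 ?lee_fin ?path_weight_ge0//.
  by case: ifP => // _; rewrite lee_fin normr_ge0.
apply: le_generation_sum => // v.
have t0' i : (0 <= (path_weight (rcons v i) w)%:E *
    (if intree X (rcons v i) w then (deviation k (rcons v i) w)%:E else 0))%E.
  rewrite mule_ge0 ?lee_fin ?path_weight_ge0//.
  by case: ifP => // _; rewrite lee_fin normr_ge0.
case: ifPn => vw; last by rewrite mule0; exact: nneseries_ge0.
rewrite (@nneseries_finite_support _ _ (offspring X v w))//; last first.
  by move=> i ni; rewrite intree_rcons ltnNge ni andbF mule0.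
under eq_bigr => i _.
  rewrite intree_rcons vw ltn_ord/= path_weight_rcons -EFinM -mulrA.
  over.
rewrite sumEFin -EFinM lee_fin -mulr_sumr ler_wpM2l ?path_weight_ge0//.
exact: deviation_contract.
Qed.

Lemma deviation_le_weighted_mass w k : regular_outcome w ->
  ((deviation k [::] w)%:E <=
   weighted_mass (fun t => (bsup (f t))%:E) k w)%E.
Proof.
move=> reg; apply: le_trans (deviation_le_generation_sum k 0 reg) _.
apply: le_generation_sum => v.
  rewrite mule_ge0 ?lee_fin ?path_weight_ge0//.
  by case: ifP => // _; rewrite lee_fin normr_ge0.
case: ifPn => // vw; rewrite lee_wpmul2l ?lee_fin ?path_weight_ge0//.
by rewrite /deviation /xplus /xminus /= subr0 (reg.1 _ vw) ger0_norm// bsup_ge0.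
Qed.

Hypothesis KE_pos : forall p, KE p [set c | 0 < c] = 1%E.
Hypothesis X_resp : forall v,
  {ae P, forall w, intree X v w -> resp X v w = f (vtype X v w)}.

Lemma ae_forall_label (Q : seq nat -> Omega -> Prop) :
  (forall v, {ae P, forall w, Q v w}) -> {ae P, forall w, forall v, Q v w}.
Proof.
move=> QP.
pose Qn n w : Prop := if unpickle n is Some v then Q v w else True.
have QnP n : {ae P, forall w, Qn n w}.
  by rewrite /Qn; case: (unpickle n) => [v|]; [exact: QP|exact: aeW].
have := ae_foralln QnP.
by apply: filterS => w Qw v; have := Qw (pickle v); rewrite /Qn pickleK.
Qed.

(** Conditionally on the typed tree the exposure has law [KE], which gives no
mass to the complement of the positive reals. *)
Lemma ae_exposure_gt0 v i :
  {ae P, forall w, intree X (rcons v i) w -> 0 < exposure X v i w}.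
Proof.
pose pos : set (measurableTypeR R) := [set c : R | 0 < c].
have mpos : measurable pos.
  rewrite (_ : pos = `]0, +oo[%classic)//.
  by apply/seteqP; split => x /=; rewrite in_itv/= andbT.
pose C : set (measurableTypeR R) := ~` pos.
have mC : measurable C by exact: measurableC.
exists (setT `&` exposure_event [:: (v, i)] (fun=> C)); split.
- by apply: measurableI => //; exact: measurable_exposure_event.
- rewrite exposure_given_typed_tree//; last first.
    exact: (@measurableT _
      (g_sigma_algebraType (\bigcup_r typed_tree_events X r))).
  apply: integral0_eq => w _; rewrite /mark_weight big_seq1/=.
  case: ifP => // _.
  set p := (vtype X v w, vtype X (rcons v i) w).
  have KEpos : KE p pos = 1%E := KE_pos p.
  have : KE p (pos `|` C) = (KE p pos + KE p C)%E by rewrite measureU// setICr.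
  rewrite setUv KEpos prob_kernel.
  by case: (KE p C) => [r| |] // [rE]; congr (_%:E); lra.
- move=> w /= nw; split => // e; rewrite inE => /eqP -> /=.
  have [vi|nvi] := boolP (intree X (rcons v i) w).
    by split => // c0; apply: nw.
  by case: nw => vi; rewrite vi in nvi.
Qed.

Lemma ae_regular_outcome : {ae P, forall w, regular_outcome w}.
Proof.
have H1 := ae_forall_label X_resp.
have H2 : {ae P, forall w, forall v i,
    intree X (rcons v i) w -> 0 < exposure X v i w}.
  apply: ae_forall_label => v; apply: ae_foralln => i.
  exact: ae_exposure_gt0.
by apply: filterS2 H1 H2 => w; split.
Qed.

Hypothesis B_integrable : mu.-integrable setT (fun t => (bsup (f t))%:E).

Lemma ae_root_coalescence :
  {ae P, forall w,
     xplus X k [::] w - xminus X k [::] w @[k --> \oo] --> (0 : R)}.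
Proof.
have mB := measurable_int mu B_integrable.
have B0 t : (0 <= (bsup (f t))%:E)%E by rewrite lee_fin bsup_ge0.
apply: filterS2 ae_regular_outcome (ae_weighted_mass_cvg0 mB B0 B_integrable).
move=> w reg mass0; apply/norm_cvg0P.
have dev0 : (deviation k [::] w)%:E @[k --> \oo] --> 0%E.
  apply: (squeeze_cvge _ (cvg_cst 0%E) mass0); apply: nearW => k /=.
  by rewrite lee_fin normr_ge0/=; exact: deviation_le_weighted_mass.
exact: (fine_cvg dev0).
Qed.

End coalescence.

End process.

Theorem corollary5p6 (R : realType) (T : completeMetricType R)
    (T_separable : separable T)
    (mu : probability (borel T) R)
    (kappa : T -> T -> R)
    (kappa_ge0 : forall s t, 0 <= kappa s t)
    (kappa_continuous : continuous (fun p : T * T => kappa p.1 p.2))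
    (kbar : R) (kappa_bounded : forall s t, `|kappa s t| <= kbar)
    (f : T -> R -> R)
    (f_Fne : forall s, Fne (f s))
    (f_measurable : measurable_fun setT (f : borel T -> response R))
    (zeta : R.-pker (borel T) ~> (measurableTypeR R))
    (KE : R.-pker (borel T * borel T) ~> (measurableTypeR R))
    (KE_pos : forall p, KE p [set c | 0 < c] = 1%E)
    (d : measure_display) (Omega : measurableType d) (P : probability Omega R)
    (X : marked_tree R T Omega)
    (X_kbp : kernel_branching_process P mu kappa zeta f KE X)
    (X_resp : forall v,
       {ae P, forall w, intree X v w -> resp X v w = f (vtype X v w)})
    (B_integrable : mu.-integrable setT (fun t => (bsup (f t))%:E)) :
  {ae P, forall w,
     xplus X k [::] w - xminus X k [::] w @[k --> \oo] --> (0 : R)}.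
Proof.
exact: (ae_root_coalescence kappa_ge0 kappa_continuous kappa_bounded X_kbp
  f_Fne KE_pos X_resp B_integrable).
Qed.
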